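(* Let $f$ satisfy the assumptions listed in the context, fix $\varepsilon>0$, put $g_\varepsilon(s)=f(s)/\varepsilon$, and set $$b_\varepsilon^+=2\sqrt{g_\varepsilon'(\alpha)}=2\sqrt{\frac{f'(\alpha)}{\varepsilon}}.$$ Then there exists $b_\varepsilon^*$ with $0<b_\varepsilon^*<b_\varepsilon^+$ such that, for $b\ge 0$ and $q_1<q_2$ in $\{0,\alpha,1\}$, the equation $$\left(\frac{v'}{\sqrt{1+(v')^2}}\right)'-b\,v'+g_\varepsilon(v)=0\qquad\text{on }\mathbb{R}$$ has a regular heteroclinic front connecting $q_1$ and $q_2$ with speed $b$ if and only if one of the following holds: (i) $q_1=\alpha$, $q_2=1$, $b\ge b_\varepsilon^+$ (in which case the front is increasing); (ii) $q_1=0$, $q_2=\alpha$, $b\ge b_\varepsilon^+$ (in which case the front is decreasing); (iii) $q_1=0$, $q_2=1$, $\varepsilon>\int_0^1 f^-(s)\,ds$ and $b=b_\varepsilon^*$ (in which case the front is increasing).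
   Context: Assumptions on $f$: $f:[0,1]\to\mathbb{R}$ is continuous, $f(0)=f(1)=0$, and there is $\alpha\in(0,1)$ with $f(\alpha)=0$ and $f(s)(s-\alpha)>0$ for every $s\in(0,1)\setminus\{\alpha\}$. Moreover $\int_0^1 f(s)\,ds>0$, the derivative $f'(\alpha)$ exists and is $>0$, and $|f(s)|\le f'(\alpha)|s-\alpha|$ for every $s\in[0,1]$. Finally there is $l>0$ such that $f(s)\ge -ls$ and $f(s)\le l(1-s)$ for every $s\in[0,1]$. Notation: $f^-=\max\{-f,0\}$. A regular heteroclinic front connecting $q_1<q_2$ is a monotone function $v\in C^2(\mathbb{R})$ with values in $[0,1]$ that solves the equation on $\mathbb{R}$ and satisfies either $v(-\infty)=q_1$, $v(+\infty)=q_2$ (increasing front), or $v(-\infty)=q_2$, $v(+\infty)=q_1$ (decreasing front). Only nonnegative speeds $b\ge 0$ are considered (replacing $v(z)$ by $v(-z)$ changes the sign of the speed and reverses the monotonicity). *)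

(* Defs.v *)
From Stdlib Require Import Reals Lra.
From Coquelicot Require Import Coquelicot.
Open Scope R_scope.

(** Functions on [0,1] are represented by total functions [R -> R] of which
    only the values on [0,1] are constrained or used. *)

Record reaction_term (f : R -> R) (alpha : R) : Prop := {
  reaction_continuous : continuous_on (fun s => 0 <= s <= 1) f;
  reaction_zero : f 0 = 0;
  reaction_one : f 1 = 0;
  reaction_alpha_range : 0 < alpha < 1;
  reaction_alpha : f alpha = 0;
  reaction_sign :
    forall s, 0 < s < 1 -> s <> alpha -> f s * (s - alpha) > 0;
  reaction_mean : RInt f 0 1 > 0;
  reaction_ex_derive : ex_derive f alpha;
  reaction_derive_pos : Derive f alpha > 0;
  reaction_tangent :
    forall s, 0 <= s <= 1 -> Rabs (f s) <= Derive f alpha * Rabs (s - alpha);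
  reaction_linear_bounds :
    exists l, l > 0 /\
      forall s, 0 <= s <= 1 -> f s >= - l * s /\ f s <= l * (1 - s)
}.

Definition neg_part (f : R -> R) (s : R) : R := Rmax (- f s) 0.

Definition g_eps (f : R -> R) (eps : R) (s : R) : R := f s / eps.

Definition b_plus (f : R -> R) (alpha eps : R) : R :=
  2 * sqrt (Derive (g_eps f eps) alpha).

Lemma b_plusE (f : R -> R) (alpha eps : R) :
  b_plus f alpha eps = 2 * sqrt (Derive f alpha / eps).
Proof.
unfold b_plus, g_eps, Rdiv; now rewrite Derive_scal_l.
Qed.

(** [Derive] is total, so differentiability at each order is required. *)
Definition C2 (v : R -> R) : Prop :=
  forall z, ex_derive v z /\ ex_derive (Derive v) z /\
            continuous (Derive (Derive v)) z.

Definition solves_front_equation (g : R -> R) (b : R) (v : R -> R) : Prop :=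
  forall z,
    Derive (fun x => Derive v x / sqrt (1 + (Derive v x) ^ 2)) z
    - b * Derive v z + g (v z) = 0.

(** [increasing] and [decreasing] are the non-strict notions of
    [Stdlib.Reals.Ranalysis1]. *)
Definition monotone (v : R -> R) : Prop := increasing v \/ decreasing v.

Definition regular_profile (g : R -> R) (b : R) (v : R -> R) : Prop :=
  C2 v /\ (forall z, 0 <= v z <= 1) /\ solves_front_equation g b v.

Definition limits (v : R -> R) (qminus qplus : R) : Prop :=
  is_lim v m_infty qminus /\ is_lim v p_infty qplus.

Definition regular_heteroclinic_front
    (g : R -> R) (b q1 q2 : R) (v : R -> R) : Prop :=
  regular_profile g b v /\ monotone v /\ (limits v q1 q2 \/ limits v q2 q1).

Definition increasing_front
    (g : R -> R) (b q1 q2 : R) (v : R -> R) : Prop :=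
  regular_profile g b v /\ increasing v /\ limits v q1 q2.

Definition decreasing_front
    (g : R -> R) (b q1 q2 : R) (v : R -> R) : Prop :=
  regular_profile g b v /\ decreasing v /\ limits v q2 q1.

(* Main.v *)
Require Import Defs.
From Stdlib Require Import Reals Ranalysis5 Lra ClassicalEpsilon.
From Coquelicot Require Import Coquelicot.
Open Scope R_scope.

(** The quantities [flux v' = v' / sqrt (1 + v'^2)] and
    [kin v' = 1 - 1 / sqrt (1 + v'^2)] satisfy, along an increasing front and as
    functions of [s = v], [d flux / ds = b - g / p] and [d kin / ds = b p - g] with
    [p = v'].

    Existence. For [y = kin p] the second equation is [y' = b R(y) - g], [R] being
    the nondecreasing inverse of [kin]. Integrated backward from [y(1) = 0] it is
    dissipative, so that (after a cap on [R]) solutions exist on all of [0,1], are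
    unique and depend continuously on [b]. If [b >= b_plus], the line
    [p = (b / 2) (s - alpha)] is a barrier and forces [y(alpha) = 0]; this gives the
    front from [alpha] to 1, and the symmetry [s -> 1 - s] the one from 0 to
    [alpha]. The intermediate value theorem applied to [b |-> y(0)] gives [bstar].
    The front itself is recovered by separating variables in [v' = p(v)].

    Necessity. The energy [kin v' + G(v)], [G' = g], has derivative [b v'^2], which
    determines the direction of a front and forces [- G(alpha) < 1] for a front
    from 0 to 1. Below [b_plus] a Riccati inequality excludes monotone solutions
    near [alpha]. Two speeds from 0 to 1 are compared through [flux] where
    [g <= 0] and then through [kin] where [g >= 0]. *)

(** Near [y = 0] the function [R] behaves like [sqrt (2 y)], so no Lipschitz condition holds where
    fronts start and end. Only the monotonicity of [R] remains, and it controls differences in one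
    direction, from 1 towards 0. At [y = 1] the function [R] blows up: [v'] becomes infinite there,
    which is the origin of the threshold on [eps]. The cap hides this singularity and must later be
    shown inactive. For fronts leaving [alpha] the line does that. For fronts from 0 to 1 the cap
    has to be fixed before the speed is known, hence a lower bound on the speed that is independent
    of the cap. A front must also take infinite time to reach its limits; the orbits therefore carry
    linear bounds at both ends. In the uniqueness of the speed, [kin] cannot serve on the left: read
    towards 0 its equation contracts differences, so the common limit 0 contradicts nothing. Where
    [g <= 0] the flux equation contracts in the other direction, so that a difference persists
    towards 0. *)

(** * Increments, extrema and one-sided barriers *)

Lemma continuous_continuity_pt (f : R -> R) (x : R) :
  continuous f x -> continuity_pt f x.
Proof. intros H; apply continuity_pt_filterlim; exact H. Qed.

Lemma is_derive_continuous (f : R -> R) (x l : R) : is_derive f x l -> continuous f x.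
Proof. intros H; apply (ex_derive_continuous f); now exists l. Qed.

Lemma is_derive_eq (f : R -> R) (x l l' : R) : is_derive f x l -> l = l' -> is_derive f x l'.
Proof. intros H <-; exact H. Qed.

Lemma continuous_eps (f : R -> R) (x : R) :
  continuous f x <->
  forall e, 0 < e -> exists d, 0 < d /\ forall t, Rabs (t - x) < d -> Rabs (f t - f x) < e.
Proof.
split.
- intros H e He.
  destruct (H (ball (f x) e)) as [d Hd]; [now exists (mkposreal e He)|].
  exists d; split; [apply cond_pos|]; intros t Ht; exact (Hd t Ht).
- intros H P [e He].
  destruct (H e (cond_pos e)) as [d [Hd H']].
  exists (mkposreal d Hd); intros t Ht; apply He, H', Ht.
Qed.

Lemma mvt (f : R -> R) a c :
  a < c ->
  (forall x, a <= x <= c -> continuous f x) ->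
  (forall x, a < x < c -> ex_derive f x) ->
  exists x, a < x < c /\ f c - f a = Derive f x * (c - a).
Proof.
intros Hac Hc Hd.
destruct (MVT f id a c) with
  (pr1 := fun x (H : a < x < c) =>
    exist (fun l => derivable_pt_abs f x l) (Derive f x)
      (proj1 (is_derive_Reals f x _) (Derive_correct f x (Hd x H))))
  (pr2 := fun x (H : a < x < c) =>
    exist (fun l => derivable_pt_abs id x l) 1 (derivable_pt_lim_id x))
  as [x [Hx E]].
- exact Hac.
- intros x Hx; now apply continuous_continuity_pt, Hc.
- intros x _; apply derivable_continuous_pt, derivable_pt_id.
- exists x; split; [exact Hx|].
  simpl in E; unfold id in E; lra.
Qed.

Lemma increment_le (f : R -> R) a c k :
  a <= c ->
  (forall x, a <= x <= c -> continuous f x) ->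
  (forall x, a < x < c -> exists l, is_derive f x l /\ l <= k) ->
  f c - f a <= k * (c - a).
Proof.
intros [Hac| ->] Hc Hd; [|lra].
destruct (mvt f a c Hac Hc) as [x [Hx ->]].
- intros x Hx; destruct (Hd x Hx) as [l [Hl _]]; now exists l.
- destruct (Hd x Hx) as [l [Hl Hk]].
  rewrite (is_derive_unique _ _ _ Hl); apply Rmult_le_compat_r; lra.
Qed.

Lemma increment_ge (f : R -> R) a c k :
  a <= c ->
  (forall x, a <= x <= c -> continuous f x) ->
  (forall x, a < x < c -> exists l, is_derive f x l /\ k <= l) ->
  k * (c - a) <= f c - f a.
Proof.
intros Hac Hc Hd.
enough (- f c - - f a <= - k * (c - a)) by lra.
apply (increment_le (fun x => - f x)); [exact Hac| |].
- intros x Hx; apply (continuous_opp f), Hc, Hx.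
- intros x Hx; destruct (Hd x Hx) as [l [Hl Hk]].
  exists (- l); split; [apply (is_derive_opp f x l Hl)|lra].
Qed.

Lemma increment_gt0 (f : R -> R) a c :
  a < c ->
  (forall x, a <= x <= c -> continuous f x) ->
  (forall x, a < x < c -> exists l, is_derive f x l /\ 0 < l) ->
  f a < f c.
Proof.
intros Hac Hc Hd.
destruct (mvt f a c Hac Hc) as [x [Hx E]].
- intros x Hx; destruct (Hd x Hx) as [l [Hl _]]; now exists l.
- destruct (Hd x Hx) as [l [Hl Hk]].
  rewrite (is_derive_unique _ _ _ Hl) in E.
  assert (0 < l * (c - a)) by (apply Rmult_lt_0_compat; lra); lra.
Qed.

Lemma is_derive_eps (f : R -> R) (x l : R) :
  is_derive f x l ->
  forall e, 0 < e -> exists d, 0 < d /\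
    forall t, Rabs (t - x) < d -> Rabs (f t - f x - l * (t - x)) <= e * Rabs (t - x).
Proof.
intros H e He.
destruct H as [_ H]; specialize (H x (fun P HP => HP) (mkposreal e He)).
destruct H as [d Hd]; exists d; split; [apply cond_pos|].
intros t Ht; specialize (Hd t Ht).
replace (l * (t - x)) with ((t - x) * l) by ring; exact Hd.
Qed.

Lemma is_derive_neg_near (f : R -> R) (x l : R) :
  is_derive f x l -> l < 0 -> forall r, 0 < r ->
  (exists t, x < t < x + r /\ f t < f x) /\ (exists t, x - r < t < x /\ f x < f t).
Proof.
intros H Hl r Hr.
destruct (is_derive_eps f x l H (- l / 2)) as [d [Hd Hf]]; [lra|].
assert (Hm : 0 < Rmin r d / 2 /\ Rmin r d / 2 < r /\ Rmin r d / 2 < d).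
{ assert (Rmin r d <= r) by apply Rmin_l; assert (Rmin r d <= d) by apply Rmin_r.
  assert (0 < Rmin r d) by now apply Rmin_glb_lt.
  lra. }
set (m := Rmin r d / 2) in *.
assert (0 < m * - l) by (apply Rmult_lt_0_compat; lra).
split.
- exists (x + m); split; [lra|].
  specialize (Hf (x + m)); replace (x + m - x) with m in Hf by ring.
  rewrite (Rabs_pos_eq m) in Hf by lra.
  specialize (Hf ltac:(lra)); apply Rabs_le_between in Hf; lra.
- exists (x - m); split; [lra|].
  specialize (Hf (x - m)); replace (x - m - x) with (- m) in Hf by ring.
  rewrite (Rabs_Ropp m), (Rabs_pos_eq m) in Hf by lra.
  specialize (Hf ltac:(lra)); apply Rabs_le_between in Hf; lra.
Qed.

Lemma is_derive_at_min (f : R -> R) (x l r : R) :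
  0 < r -> is_derive f x l -> (forall t, Rabs (t - x) < r -> f x <= f t) -> l = 0.
Proof.
intros Hr H Hmin.
destruct (Rtotal_order l 0) as [Hl|[Hl|Hl]]; [|exact Hl|].
- destruct (proj1 (is_derive_neg_near f x l H Hl r Hr)) as [t [Ht Hft]].
  specialize (Hmin t); rewrite Rabs_pos_eq in Hmin; lra.
- destruct (proj2 (is_derive_neg_near (fun t => - f t) x (- l)
    (is_derive_opp f x l H) ltac:(lra) r Hr)) as [t [Ht Hft]].
  specialize (Hmin t); rewrite Rabs_left in Hmin; lra.
Qed.

(** A continuation argument. The slope of [D] is controlled only where [D < 0], but the linear bound
    itself stays negative up to [c], so the supremum [m] of the points up to which [D] is negative
    cannot lie before [c]. With [k = 0] it says that a negative [D] never recovers. *)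
Lemma barrier (D : R -> R) a c k :
  a <= c -> 0 <= k ->
  (forall x, a <= x <= c -> continuous D x) ->
  D a < 0 -> D a + k * (c - a) < 0 ->
  (forall x, a < x < c -> D x < 0 -> exists l, is_derive D x l /\ l <= k) ->
  forall x, a <= x <= c -> D x <= D a + k * (x - a).
Proof.
intros Hac Hk Hc Ha0 Ha Hd.
set (E := fun x => a <= x <= c /\ forall t, a <= t <= x -> D t < 0).
assert (HEa : E a).
{ split; [lra|]; intros t Ht; now replace t with a by lra. }
destruct (completeness E) as [m [Hub Hlub]].
{ exists c; intros x [Hx _]; lra. }
{ now exists a. }
assert (Ham : a <= m) by now apply Hub.
assert (Hmc : m <= c) by (apply Hlub; intros x [Hx _]; lra).
assert (Hneg : forall t, a <= t < m -> D t < 0).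
{ intros t Ht; apply Rnot_le_lt; intros Hn.
  assert (m <= t); [|lra].
  apply Hlub; intros x [Hx Hx']; apply Rnot_lt_le; intros Hlt.
  specialize (Hx' t); lra. }
assert (Hle : forall x, a <= x <= m -> D x <= D a + k * (x - a)).
{ intros x Hx.
  assert (D x - D a <= k * (x - a)); [|lra].
  apply increment_le; [lra| |].
  - intros t Ht; apply Hc; lra.
  - intros t Ht; apply Hd; [lra|]; apply Hneg; lra. }
destruct (Req_dec m c) as [<-|Hne]; [exact Hle|exfalso].
assert (Hm : D m < 0).
{ specialize (Hle m ltac:(lra)).
  assert (k * (m - a) <= k * (c - a)) by (apply Rmult_le_compat_l; lra); lra. }
destruct (proj1 (continuous_eps D m) (Hc m ltac:(lra)) (- D m)) as [d [Hd0 Hd1]]; [lra|].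
set (x := Rmin c (m + d / 2)).
assert (Hx : m < x <= m + d / 2 /\ x <= c).
{ unfold x; split; [split|].
  - apply Rmin_glb_lt; lra.
  - apply Rmin_r.
  - apply Rmin_l. }
assert (E x).
{ split; [lra|]; intros t Ht.
  destruct (Rlt_le_dec t m); [apply Hneg; lra|].
  specialize (Hd1 t); rewrite Rabs_pos_eq in Hd1 by lra.
  specialize (Hd1 ltac:(lra)); apply Rabs_lt_between in Hd1; lra. }
assert (x <= m) by now apply Hub.
lra.
Qed.

(** A value above [k * (x - a)] would, followed to the left from [x], stay positive down to [a]:
    this is [barrier] for [t |-> - D (x - t)]. *)
Lemma barrier_backward (D : R -> R) a c k :
  a <= c -> 0 <= k ->
  (forall x, a <= x <= c -> continuous D x) ->
  D a <= 0 ->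
  (forall x, a < x < c -> 0 < D x -> exists l, is_derive D x l /\ l <= k) ->
  forall x, a <= x <= c -> D x <= k * (x - a).
Proof.
intros Hac Hk Hc Ha Hd x Hx; apply Rnot_lt_le; intros Hlt.
assert (0 <= k * (x - a)) by (apply Rmult_le_pos; lra).
assert (H' : - D (x - (x - a)) <= - D (x - 0) + k * (x - a - 0)).
{ apply (barrier (fun t => - D (x - t)) 0 (x - a)); try lra.
  - intros t Ht; apply (continuous_opp (fun t => D (x - t))).
    apply (continuous_comp (fun t => x - t) D).
    + apply (continuous_minus (fun _ => x) (fun t => t));
        [apply continuous_const|apply continuous_id].
    + apply Hc; lra.
  - rewrite Rminus_0_r; lra.
  - rewrite Rminus_0_r; lra.
  - intros t Ht Hneg.
    destruct (Hd (x - t)) as [l [Hl Hlk]]; [lra|lra|].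
    exists l; split; [|exact Hlk].
    assert (Hs : is_derive (fun t => x - t) t (-1)) by (auto_derive; [trivial|ring]).
    refine (is_derive_eq _ _ _ _ (is_derive_opp _ _ _ (is_derive_comp D _ t l _ Hl Hs)) _).
    unfold scal, opp; simpl; unfold mult; simpl; ring. }
replace (x - (x - a)) with a in H' by ring; rewrite !Rminus_0_r in H'.
lra.
Qed.

(** * Dissipative scalar equations *)

Lemma is_derive_primitive (f : R -> R) (a x : R) :
  (forall t, continuous f t) -> is_derive (fun t => RInt f a t) x (f x).
Proof.
intros Hf; apply (is_derive_RInt f (fun t => RInt f a t) a x); [|apply Hf].
apply filter_forall; intros t; apply (RInt_correct f), ex_RInt_continuous.
intros z _; apply Hf.
Qed.

Definition clamp (c x : R) : R := Rmax 0 (Rmin x c).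

Lemma clamp_range c x : 0 <= c -> 0 <= clamp c x <= c.
Proof.
intros Hc; unfold clamp; split; [apply Rmax_l|].
apply Rmax_lub; [exact Hc|apply Rmin_r].
Qed.

Lemma clamp_id c x : 0 <= x <= c -> clamp c x = x.
Proof. intros Hx; unfold clamp; rewrite Rmin_left, Rmax_right; lra. Qed.

Lemma clamp_below c x : 0 <= c -> x <= 0 -> clamp c x = 0.
Proof.
intros Hc Hx; unfold clamp; apply Rmax_left.
apply Rle_trans with (2 := Hx), Rmin_l.
Qed.

Lemma clamp_above c x : 0 <= c -> c <= x -> clamp c x = c.
Proof. intros Hc Hx; unfold clamp; rewrite Rmin_right, Rmax_right; lra. Qed.

Lemma clamp_mono c x y : x <= y -> clamp c x <= clamp c y.
Proof.
intros Hxy; unfold clamp; apply Rle_max_compat_l.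
now apply Rle_min_compat_r.
Qed.

Lemma clamp_lipschitz c x y : 0 <= c -> Rabs (clamp c x - clamp c y) <= Rabs (x - y).
Proof.
intros Hc; unfold clamp, Rmin.
destruct (Rle_dec x c), (Rle_dec y c); unfold Rmax;
  repeat destruct (Rle_dec 0 _); unfold Rabs; repeat destruct (Rcase_abs _); lra.
Qed.

Lemma continuous_clamp c x : 0 <= c -> continuous (clamp c) x.
Proof.
intros Hc; apply continuous_eps; intros e He; exists e; split; [exact He|].
intros t Ht; apply Rle_lt_trans with (2 := Ht); now apply clamp_lipschitz.
Qed.

Lemma continuous_Rmax0_minus d x : continuous (fun t => Rmax 0 (t - d)) x.
Proof.
apply continuous_eps; intros e He; exists e; split; [exact He|].
intros t Ht; apply Rle_lt_trans with (2 := Ht).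
unfold Rmax.
repeat destruct (Rle_dec 0 _); unfold Rabs; repeat destruct (Rcase_abs _); lra.
Qed.

Definition approx_solution (H phi : R -> R) (e : R) (U : R -> R) : Prop :=
  U 0 = 0 /\
  forall t, 0 <= t <= 1 -> exists l, is_derive U t l /\ Rabs (l - (H t - phi (U t))) <= e.

(* The right-hand side [H t - phi u] is nonincreasing in [u], so errors do not
   amplify; no Lipschitz condition on [phi] is needed. *)
Lemma approx_solution_close H phi e1 e2 U1 U2 t :
  (forall x y, x <= y -> phi x <= phi y) -> 0 <= e1 -> 0 <= e2 ->
  approx_solution H phi e1 U1 -> approx_solution H phi e2 U2 ->
  0 <= t <= 1 -> U1 t - U2 t <= (e1 + e2) * t.
Proof.
intros Hphi He1 He2 [H10 H1] [H20 H2] Ht.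
replace ((e1 + e2) * t) with ((e1 + e2) * (t - 0)) by ring.
apply (barrier_backward (fun t => U1 t - U2 t) 0 1); try lra.
- intros x Hx; destruct (H1 x Hx) as [l1 [Hl1 _]], (H2 x Hx) as [l2 [Hl2 _]].
  apply (is_derive_continuous _ _ _ (is_derive_minus U1 U2 x l1 l2 Hl1 Hl2)).
- intros x Hx Hpos.
  destruct (H1 x ltac:(lra)) as [l1 [Hl1 B1]], (H2 x ltac:(lra)) as [l2 [Hl2 B2]].
  exists (l1 - l2); split; [apply (is_derive_minus U1 U2 x l1 l2 Hl1 Hl2)|].
  specialize (Hphi (U2 x) (U1 x) ltac:(lra)).
  apply Rabs_le_between in B1; apply Rabs_le_between in B2; lra.
Qed.

(** Tonelli's scheme: with the unknown read at time [s - d], the integral equation becomes explicit,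
    and each iteration extends the interval of validity by [d]. *)
Fixpoint delay_iter (H phi : R -> R) (d : R) (k : nat) : R -> R :=
  match k with
  | O => fun _ => 0
  | S k => fun t => RInt (fun s => H s - phi (delay_iter H phi d k (Rmax 0 (s - d)))) 0 t
  end.

Lemma continuous_delay_integrand H phi d (Y : R -> R) t :
  (forall x, continuous H x) -> (forall x, continuous phi x) ->
  (forall x, continuous Y x) ->
  continuous (fun s => H s - phi (Y (Rmax 0 (s - d)))) t.
Proof.
intros CH Cphi CY; apply (continuous_minus H); [apply CH|].
apply (continuous_comp (fun s => Y (Rmax 0 (s - d))) phi); [|apply Cphi].
apply (continuous_comp (fun s => Rmax 0 (s - d)) Y); [|apply CY].
apply continuous_Rmax0_minus.
Qed.

Lemma continuous_delay_iter H phi d k t :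
  (forall x, continuous H x) -> (forall x, continuous phi x) ->
  continuous (delay_iter H phi d k) t.
Proof.
intros CH Cphi; revert t; induction k as [|k IH]; intros t; simpl.
- apply continuous_const.
- refine (is_derive_continuous _ t _ (is_derive_primitive _ 0 t _)).
  intros x; now apply continuous_delay_integrand.
Qed.

(** The integrand at [s] reads the previous iterate at [s - d] only, hence agreement of two iterates
    up to [k d] passes to the next pair up to [(k + 1) d]. *)
Lemma delay_iter_stable H phi d k t :
  0 < d -> 0 <= t <= INR k * d ->
  delay_iter H phi d (S k) t = delay_iter H phi d k t.
Proof.
intros Hd; revert t; induction k as [|k IH]; intros t Ht.
- simpl in *; replace t with 0 by lra; exact (RInt_point (V := R_CompleteNormedModule) 0 _).
- change (RInt (fun s => H s - phi (delay_iter H phi d (S k) (Rmax 0 (s - d)))) 0 t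
    = RInt (fun s => H s - phi (delay_iter H phi d k (Rmax 0 (s - d)))) 0 t).
  apply RInt_ext; intros x Hx; rewrite Rmin_left, Rmax_right in Hx by lra.
  f_equal; f_equal; apply IH; split; [apply Rmax_l|].
  rewrite S_INR in Ht.
  apply Rmax_lub; [|lra]; apply Rmult_le_pos; [apply pos_INR|lra].
Qed.

Lemma delay_equation_solution H phi d :
  (forall x, continuous H x) -> (forall x, continuous phi x) -> 0 < d ->
  exists U, U 0 = 0 /\
    forall t, 0 <= t <= 1 -> is_derive U t (H t - phi (U (Rmax 0 (t - d)))).
Proof.
intros CH Cphi Hd.
destruct (INR_archimed d 1 Hd) as [N HN].
exists (delay_iter H phi d (S N)); split; [exact (RInt_point (V := R_CompleteNormedModule) 0 _)|].
intros t Ht.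
assert (HM : 0 <= Rmax 0 (t - d) <= INR N * d).
{ split; [apply Rmax_l|]; apply Rmax_lub; lra. }
rewrite (delay_iter_stable H phi d N _ Hd HM).
apply (is_derive_primitive (fun s => H s - phi (delay_iter H phi d N (Rmax 0 (s - d))))).
intros x; apply continuous_delay_integrand; auto.
intros z; now apply continuous_delay_iter.
Qed.

Definition uniformly_continuous (phi : R -> R) : Prop :=
  forall e, 0 < e -> exists d, 0 < d /\
    forall x y, Rabs (x - y) < d -> Rabs (phi x - phi y) < e.

Lemma uniformly_continuous_continuous (phi : R -> R) (x : R) :
  uniformly_continuous phi -> continuous phi x.
Proof.
intros H; apply continuous_eps; intros e He.
destruct (H e He) as [d [Hd H']]; exists d; auto.
Qed.

Lemma approx_solution_exists (H phi : R -> R) M e :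
  (forall x, continuous H x) -> uniformly_continuous phi ->
  (forall x u, Rabs (H x - phi u) <= M) -> 0 < e ->
  exists U, approx_solution H phi e U.
Proof.
intros CH Uphi HM He.
assert (HM0 : 0 <= M) by (apply Rle_trans with (2 := HM 0 0), Rabs_pos).
destruct (Uphi e He) as [d [Hd Hphi]].
assert (HK : 0 < 2 * (M + 1)) by lra.
(* [U] is [M]-Lipschitz on [0,1], so over one delay it moves by at most [M * del < d], and the
   delayed term differs from the true one by less than [e]. *)
set (del := d / (2 * (M + 1))).
assert (Hdel : 0 < del) by (now apply Rdiv_lt_0_compat).
destruct (delay_equation_solution H phi del CH) as [U [U0 HU]].
{ intros x; now apply uniformly_continuous_continuous. }
{ exact Hdel. }
exists U; split; [exact U0|]; intros t Ht.
exists (H t - phi (U (Rmax 0 (t - del)))); split; [now apply HU|].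
replace (H t - phi (U (Rmax 0 (t - del))) - (H t - phi (U t)))
  with (phi (U t) - phi (U (Rmax 0 (t - del)))) by ring.
apply Rlt_le, Hphi.
set (r := Rmax 0 (t - del)).
assert (Hr : 0 <= r <= t /\ t - r <= del).
{ unfold r; split; [split; [apply Rmax_l|apply Rmax_lub; lra]|].
  assert (t - del <= Rmax 0 (t - del)) by apply Rmax_r; lra. }
assert (CU : forall x, r <= x <= t -> continuous U x).
{ intros x Hx; apply (is_derive_continuous U x _ (HU x ltac:(lra))). }
assert (I1 : U t - U r <= M * (t - r)).
{ apply increment_le; [lra|exact CU|]; intros x Hx.
  eexists; split; [apply HU; lra|].
  eapply Rle_trans; [apply Rle_abs|apply HM]. }
assert (I2 : - M * (t - r) <= U t - U r).
{ apply increment_ge; [lra|exact CU|]; intros x Hx.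
  eexists; split; [apply HU; lra|].
  specialize (HM x (U (Rmax 0 (x - del)))); apply Rabs_le_between in HM; lra. }
assert (M * (t - r) <= M * del) by (apply Rmult_le_compat_l; lra).
assert ((M + 1) * del = d / 2) by (unfold del; field; lra).
apply Rabs_lt_between; lra.
Qed.

Lemma cauchy_limit (u e : nat -> R) :
  is_lim_seq e 0 -> (forall n m, Rabs (u n - u m) <= e n + e m) ->
  exists y, forall n, Rabs (u n - y) <= e n.
Proof.
intros He Hu.
assert (Hc : ex_finite_lim_seq u).
{ apply ex_lim_seq_cauchy_corr; intros eta.
  destruct (proj2 (is_lim_seq_spec _ _) He (pos_div_2 eta)) as [N HN].
  exists N; intros n m Hn Hm.
  generalize (HN n Hn) (HN m Hm); simpl; rewrite !Rminus_0_r.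
  intros H1 H2; apply Rabs_lt_between in H1; apply Rabs_lt_between in H2.
  apply Rle_lt_trans with (1 := Hu n m); lra. }
destruct Hc as [y Hy]; exists y; intros n.
assert (L1 : is_lim_seq (fun m => Rabs (u n - u m)) (Rabs (u n - y))).
{ apply (is_lim_seq_abs _ (u n - y)).
  apply (is_lim_seq_minus' (fun _ => u n) u); [apply is_lim_seq_const|exact Hy]. }
assert (L2 : is_lim_seq (fun m => e n + e m) (e n + 0)).
{ apply (is_lim_seq_plus' (fun _ => e n) e); [apply is_lim_seq_const|exact He]. }
rewrite Rplus_0_r in L2.
exact (is_lim_seq_le _ _ _ _ (fun m => Hu n m) L1 L2).
Qed.

Lemma dissipative_solution_exists (H phi : R -> R) M :
  (forall x, continuous H x) -> uniformly_continuous phi ->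
  (forall x y, x <= y -> phi x <= phi y) ->
  (forall x u, Rabs (H x - phi u) <= M) ->
  exists y, y 0 = 0 /\ forall t, 0 <= t <= 1 -> is_derive y t (H t - phi (y t)).
Proof.
intros CH Uphi Mphi HM.
set (e := fun n => / (INR n + 1)).
assert (He : forall n, 0 < e n) by (intros n; apply RinvN_pos).
assert (Le : is_lim_seq e 0).
{ apply is_lim_seq_Reals; intros eta Heta.
  destruct (RinvN_cv Heta) as [N HN]; exists N; intros n Hn; now apply HN. }
set (U := fun n => proj1_sig (constructive_indefinite_description _
  (approx_solution_exists H phi M (e n) CH Uphi HM (He n)))).
assert (HU : forall n, approx_solution H phi (e n) (U n)).
{ intros n; exact (proj2_sig (constructive_indefinite_description _
  (approx_solution_exists H phi M (e n) CH Uphi HM (He n)))). }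
assert (Hclose : forall t, 0 <= t <= 1 -> exists y, forall n, Rabs (U n t - y) <= e n).
{ intros t Ht; apply cauchy_limit; [exact Le|]; intros n m.
  assert (A : forall n m, U n t - U m t <= e n + e m).
  { intros n' m'.
    eapply Rle_trans;
      [apply (approx_solution_close H phi (e n') (e m')); auto; apply Rlt_le, He|].
    rewrite <- (Rmult_1_r (e n' + e m')) at 2.
    generalize (He n') (He m'); intros; apply Rmult_le_compat_l; lra. }
  generalize (A n m) (A m n); intros; apply Rabs_le_between; lra. }
assert (H01 : forall t, 0 <= clamp 1 t <= 1) by (intros t; apply clamp_range; lra).
(* The clamp makes the limit continuous on the whole line, as its use under the integral [V]
   requires. *)
set (y := fun t => proj1_sig (constructive_indefinite_description _
  (Hclose (clamp 1 t) (H01 t)))).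
assert (Hy : forall t n, Rabs (U n (clamp 1 t) - y t) <= e n).
{ intros t; exact (proj2_sig (constructive_indefinite_description _
  (Hclose (clamp 1 t) (H01 t)))). }
assert (Hsmall : forall eta, 0 < eta -> exists n, e n < eta).
{ intros eta Heta.
  destruct (proj2 (is_lim_seq_spec _ _) Le (mkposreal eta Heta)) as [N HN].
  exists N; specialize (HN N (Nat.le_refl N)); simpl in HN.
  rewrite Rminus_0_r, Rabs_pos_eq in HN; [exact HN|apply Rlt_le, He]. }
assert (Cy : forall t, continuous y t).
{ intros t; apply continuous_eps; intros eta Heta.
  destruct (Hsmall (eta / 3)) as [n Hn]; [lra|].
  assert (CU : continuous (fun t => U n (clamp 1 t)) t).
  { apply (continuous_comp (clamp 1) (U n)); [apply continuous_clamp; lra|].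
    destruct (HU n) as [_ Hd], (Hd _ (H01 t)) as [l [Hl _]].
    apply (is_derive_continuous _ _ _ Hl). }
  destruct (proj1 (continuous_eps _ _) CU (eta / 3)) as [d [Hd Hcd]]; [lra|].
  exists d; split; [exact Hd|]; intros x Hx; specialize (Hcd x Hx).
  generalize (Hy x n) (Hy t n); intros A B.
  apply Rabs_le_between in A; apply Rabs_le_between in B.
  apply Rabs_lt_between in Hcd; apply Rabs_lt_between; lra. }
assert (CG : forall t, continuous (fun s => H s - phi (y s)) t).
{ intros t; apply (continuous_minus H); [apply CH|].
  apply (continuous_comp y phi); [apply Cy|now apply uniformly_continuous_continuous]. }
(* The clamped limit [y] is constant outside [0,1] and may fail to be differentiable at the
   endpoints. The primitive [V] has a two-sided derivative there and agrees with [y] on [0,1], so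
   [V] is the solution returned. *)
set (V := fun t => RInt (fun s => H s - phi (y s)) 0 t).
assert (dV : forall t, is_derive V t (H t - phi (y t))).
{ intros t; now apply (is_derive_primitive (fun s => H s - phi (y s))). }
assert (V0 : V 0 = 0) by exact (RInt_point (V := R_CompleteNormedModule) 0 _).
assert (HV : forall t, 0 <= t <= 1 -> V t = y t).
{ intros t Ht; apply cond_eq; intros eta Heta.
  destruct (Uphi (eta / 4)) as [d [Hd Hphi]]; [lra|].
  destruct (Hsmall (Rmin d (eta / 4))) as [n Hn].
  { apply Rmin_glb_lt; lra. }
  assert (e n < d) by (apply Rlt_le_trans with (1 := Hn), Rmin_l).
  assert (e n < eta / 4) by (apply Rlt_le_trans with (1 := Hn), Rmin_r).
  destruct (HU n) as [Un0 dU].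
  assert (dD : forall x, 0 <= x <= 1 -> exists l,
    is_derive (fun t => U n t - V t) x l /\ Rabs l <= eta / 2).
  { intros x Hx; destruct (dU x Hx) as [l [Hl Bl]].
    exists (l - (H x - phi (y x))); split.
    - apply (is_derive_minus (U n) V x _ _ Hl (dV x)).
    - generalize (Hy x n); rewrite clamp_id by lra; intros Hyx.
      specialize (Hphi (U n x) (y x) ltac:(lra)).
      apply Rabs_lt_between in Hphi; apply Rabs_le_between in Bl.
      apply Rabs_le_between; lra. }
  assert (CD : forall x, 0 <= x <= t -> continuous (fun t => U n t - V t) x).
  { intros x Hx; destruct (dD x ltac:(lra)) as [l [Hl _]].
    apply (is_derive_continuous _ _ _ Hl). }
  assert (I1 : (U n t - V t) - (U n 0 - V 0) <= eta / 2 * (t - 0)).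
  { apply (increment_le (fun t => U n t - V t)); [lra|exact CD|].
    intros x Hx; destruct (dD x ltac:(lra)) as [l [Hl Bl]].
    exists l; split; [exact Hl|]; apply Rabs_le_between in Bl; lra. }
  assert (I2 : - (eta / 2) * (t - 0) <= (U n t - V t) - (U n 0 - V 0)).
  { apply (increment_ge (fun t => U n t - V t)); [lra|exact CD|].
    intros x Hx; destruct (dD x ltac:(lra)) as [l [Hl Bl]].
    exists l; split; [exact Hl|]; apply Rabs_le_between in Bl; lra. }
  assert (eta / 2 * (t - 0) <= eta / 2 * 1) by (apply Rmult_le_compat_l; lra).
  generalize (Hy t n); rewrite clamp_id by lra; intros Hyt.
  apply Rabs_le_between in Hyt; apply Rabs_lt_between; lra. }
exists V; split; [exact V0|]; intros t Ht.
rewrite HV by exact Ht; apply dV.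
Qed.

(** * Flux and kinetic energy *)

(* With [p = v'], the equation reads [v'' = curv p * (b p - g v)]; along a
   solution, [flux p]' [= b p - g v] and [kin p]' [= p (b p - g v)]. *)
Definition curv (p : R) : R := (1 + p ^ 2) * sqrt (1 + p ^ 2).
Definition flux (p : R) : R := p / sqrt (1 + p ^ 2).
Definition kin (p : R) : R := 1 - / sqrt (1 + p ^ 2).
Definition slope (y : R) : R := sqrt (/ (1 - y) ^ 2 - 1).

Lemma sqrt_1p2_ge1 p : 1 <= sqrt (1 + p ^ 2).
Proof. rewrite <- sqrt_1 at 1; apply sqrt_le_1_alt; nra. Qed.

Lemma sqrt_1p2_sqr p : sqrt (1 + p ^ 2) * sqrt (1 + p ^ 2) = 1 + p ^ 2.
Proof. apply sqrt_sqrt; nra. Qed.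

Lemma curv_ge1 p : 1 <= curv p.
Proof. unfold curv; generalize (sqrt_1p2_ge1 p); nra. Qed.

Lemma curv_opp p : curv (- p) = curv p.
Proof. unfold curv; now replace ((- p) ^ 2) with (p ^ 2) by ring. Qed.

Lemma kin_range p : 0 <= kin p < 1.
Proof.
unfold kin; generalize (sqrt_1p2_ge1 p); intros H; split.
- assert (/ sqrt (1 + p ^ 2) <= / 1) by (apply Rinv_le_contravar; lra); lra.
- assert (0 < / sqrt (1 + p ^ 2)) by (apply Rinv_0_lt_compat; lra); lra.
Qed.

Lemma kin_0 : kin 0 = 0.
Proof. unfold kin; replace (1 + 0 ^ 2) with 1 by ring; rewrite sqrt_1; field. Qed.

Lemma kin_opp p : kin (- p) = kin p.
Proof. unfold kin; now replace ((- p) ^ 2) with (p ^ 2) by ring. Qed.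

Lemma flux_0 : flux 0 = 0.
Proof. unfold flux, Rdiv; ring. Qed.

Lemma is_derive_kin (p : R) : is_derive kin p (p / curv p).
Proof.
unfold kin, curv; generalize (sqrt_1p2_ge1 p) (sqrt_1p2_sqr p); intros H1 H2.
auto_derive; replace (1 + p * (p * 1)) with (1 + p ^ 2) by ring;
  [repeat split; nra|].
rewrite H2; field; nra.
Qed.

Lemma is_derive_flux (p : R) : is_derive flux p (/ curv p).
Proof.
unfold flux, curv; generalize (sqrt_1p2_ge1 p) (sqrt_1p2_sqr p); intros H1 H2.
auto_derive; replace (1 + p * (p * 1)) with (1 + p ^ 2) by ring;
  [repeat split; nra|].
rewrite H2.
set (s := sqrt (1 + p ^ 2)) in *.
replace (1 + p ^ 2) with (s * s).
field_simplify_eq; [|lra].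
replace (p ^ 2) with (s * s - 1) by lra; ring.
Qed.

Lemma kin_lt p q : 0 <= p < q -> kin p < kin q.
Proof.
intros H; apply increment_gt0; [lra| |].
- intros x _; apply (is_derive_continuous _ _ _ (is_derive_kin x)).
- intros x Hx; exists (x / curv x); split; [apply is_derive_kin|].
  apply Rdiv_lt_0_compat; [lra|]; generalize (curv_ge1 x); lra.
Qed.

Lemma kin_le p q : 0 <= p <= q -> kin p <= kin q.
Proof.
intros [H1 [H2| ->]]; [|lra]; apply Rlt_le, kin_lt; lra.
Qed.

Lemma flux_le p q : p <= q -> flux p <= flux q.
Proof.
intros [H| ->]; [|lra]; apply Rlt_le, increment_gt0; [exact H| |].
- intros x _; apply (is_derive_continuous _ _ _ (is_derive_flux x)).
- intros x Hx; exists (/ curv x); split; [apply is_derive_flux|].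
  apply Rinv_0_lt_compat; generalize (curv_ge1 x); lra.
Qed.

Lemma slope_ge0 y : 0 <= slope y.
Proof. apply sqrt_pos. Qed.

Lemma slope_sqr y : 0 <= y < 1 -> slope y ^ 2 = / (1 - y) ^ 2 - 1.
Proof.
intros Hy; unfold slope; apply pow2_sqrt.
assert (/ 1 <= / (1 - y) ^ 2); [|lra].
apply Rinv_le_contravar; nra.
Qed.

Lemma sqrt_1_slope y : 0 <= y < 1 -> sqrt (1 + slope y ^ 2) = / (1 - y).
Proof.
intros Hy; rewrite slope_sqr by exact Hy.
replace (1 + (/ (1 - y) ^ 2 - 1)) with ((/ (1 - y)) ^ 2) by (field; lra).
apply sqrt_pow2, Rlt_le, Rinv_0_lt_compat; lra.
Qed.

Lemma kin_slope y : 0 <= y < 1 -> kin (slope y) = y.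
Proof. intros Hy; unfold kin; rewrite sqrt_1_slope, Rinv_inv by exact Hy; ring. Qed.

Lemma slope_kin p : 0 <= p -> slope (kin p) = p.
Proof.
intros Hp; unfold slope, kin.
generalize (sqrt_1p2_ge1 p) (sqrt_1p2_sqr p); intros H1 H2.
replace (1 - (1 - / sqrt (1 + p ^ 2))) with (/ sqrt (1 + p ^ 2)) by ring.
rewrite pow_inv, Rinv_inv.
transitivity (sqrt (p ^ 2)); [f_equal|now apply sqrt_pow2].
replace (sqrt (1 + p ^ 2) ^ 2) with (sqrt (1 + p ^ 2) * sqrt (1 + p ^ 2)) by ring.
rewrite H2; ring.
Qed.

Lemma slope_0 : slope 0 = 0.
Proof. rewrite <- kin_0 at 1; apply slope_kin; lra. Qed.

Lemma slope_le y z : 0 <= y <= z -> z < 1 -> slope y <= slope z.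
Proof.
intros H Hz; apply sqrt_le_1_alt.
assert (/ (1 - y) ^ 2 <= / (1 - z) ^ 2); [|lra].
apply Rinv_le_contravar; [apply pow_lt; lra|]; apply pow_incr; lra.
Qed.

Lemma slope_gt0 y : 0 < y < 1 -> 0 < slope y.
Proof.
intros Hy; apply sqrt_lt_R0.
assert (/ 1 < / (1 - y) ^ 2); [|lra].
apply Rinv_lt_contravar; nra.
Qed.

Lemma is_derive_slope (y : R) :
  0 < y < 1 -> is_derive slope y (curv (slope y) / slope y).
Proof.
intros Hy; generalize (slope_gt0 y Hy); intros Hs.
generalize (slope_sqr y ltac:(lra)); intros Hsq.
unfold curv; rewrite sqrt_1_slope, Hsq by lra.
unfold slope at 1; auto_derive.
- split; [nra|]; split; [|trivial].
  replace ((1 + - y) * ((1 + - y) * 1)) with ((1 - y) ^ 2) by ring; nra.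
- replace ((1 + - y) * ((1 + - y) * 1)) with ((1 - y) ^ 2) by ring.
  change (sqrt (/ (1 - y) ^ 2 + - (1))) with (slope y); field; lra.
Qed.

Lemma continuous_slope (y : R) : y < 1 -> continuous slope y.
Proof.
intros Hy.
apply (continuous_comp (fun y => / (1 - y) ^ 2 - 1) sqrt).
- apply (ex_derive_continuous (fun y => / (1 - y) ^ 2 - 1)); auto_derive; nra.
- apply continuous_sqrt.
Qed.

(** Since [slope y ^ 2 = y (2 - y) / (1 - y) ^ 2], a quadratic decay of the energy at distance [d]
    from an endpoint gives a linear decay of the slope there. *)
Lemma slope_le_quadratic y c d l :
  0 <= y <= c -> c < 1 -> 0 <= d -> 0 <= l -> y <= l * d ^ 2 / 2 ->
  slope y <= sqrt l / (1 - c) * d.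
Proof.
intros Hy Hc Hd Hl Hyd.
assert (Hi : 0 < / (1 - c)) by (apply Rinv_0_lt_compat; lra).
assert (0 <= sqrt l / (1 - c) * d).
{ apply Rmult_le_pos; [|exact Hd]; apply Rmult_le_pos; [apply sqrt_pos|lra]. }
rewrite <- (sqrt_pow2 (sqrt l / (1 - c) * d)) by assumption.
apply sqrt_le_1_alt.
replace ((sqrt l / (1 - c) * d) ^ 2) with (sqrt l ^ 2 * d ^ 2 * / (1 - c) ^ 2)
  by (field; lra).
rewrite pow2_sqrt by exact Hl.
apply Rle_trans with (2 * y * / (1 - c) ^ 2).
- apply Rle_trans with (2 * y * / (1 - y) ^ 2).
  + replace (/ (1 - y) ^ 2 - 1) with (y * (2 - y) * / (1 - y) ^ 2) by (field; lra).
    apply Rmult_le_compat_r; [|nra].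
    apply Rlt_le, Rinv_0_lt_compat, pow_lt; lra.
  + apply Rmult_le_compat_l; [lra|]; apply Rinv_le_contravar; [apply pow_lt; lra|].
    apply pow_incr; lra.
- apply Rmult_le_compat_r; [|lra].
  apply Rlt_le, Rinv_0_lt_compat, pow_lt; lra.
Qed.

(** As [kin P < 1], the clamp avoids the singularity of [slope] at 1 and extends it by 0 to negative
    energies. The result is bounded, nondecreasing and uniformly continuous on the line, and a shot
    may end below zero, which the intermediate value argument exploits. *)
Definition capped_slope (P y : R) : R := slope (clamp (kin P) y).

Lemma capped_slope_le P y z : y <= z -> capped_slope P y <= capped_slope P z.
Proof.
intros H; generalize (kin_range P); intros HP; apply slope_le.
- split; [apply clamp_range; lra|now apply clamp_mono].
- generalize (clamp_range (kin P) z); lra.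
Qed.

Lemma capped_slope_nonpos P y : y <= 0 -> capped_slope P y = 0.
Proof.
intros H; unfold capped_slope; rewrite clamp_below; [apply slope_0| |exact H].
apply kin_range.
Qed.

Lemma capped_slope_ge P y : 0 <= P -> kin P <= y -> capped_slope P y = P.
Proof.
intros HP H; unfold capped_slope; rewrite clamp_above; [now apply slope_kin| |exact H].
apply kin_range.
Qed.

Lemma capped_slope_id P y : 0 <= y <= kin P -> capped_slope P y = slope y.
Proof. intros H; unfold capped_slope; now rewrite clamp_id. Qed.

Lemma capped_slope_kin P p : 0 <= p <= P -> capped_slope P (kin p) = p.
Proof.
intros H; rewrite capped_slope_id; [apply slope_kin; lra|].
split; [apply kin_range|now apply kin_le].
Qed.

Lemma capped_slope_range P y : 0 <= P -> 0 <= capped_slope P y <= P.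
Proof.
intros HP; split; [apply slope_ge0|].
destruct (Rle_lt_dec (kin P) y) as [H|H].
- rewrite capped_slope_ge; lra.
- rewrite <- (capped_slope_ge P (kin P)) at 2; [|lra|lra].
  apply capped_slope_le; lra.
Qed.

Lemma capped_slope_uniformly_continuous P : uniformly_continuous (capped_slope P).
Proof.
intros e He; generalize (kin_range P); intros HP.
destruct (@Heine_cor2 slope 0 (kin P)) with (eps := mkposreal e He) as [d Hd].
{ intros x Hx; apply continuous_continuity_pt, continuous_slope; lra. }
exists d; split; [apply cond_pos|]; intros x y Hxy.
apply Hd; [apply clamp_range; lra|apply clamp_range; lra|].
apply Rle_lt_trans with (2 := Hxy), clamp_lipschitz; lra.
Qed.

(** * Energy as a function of the state *)

(** The assumptions on [g], carried over to an extension by zero so that continuity holds on the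
    whole line; [ga] is [h'(al)]. *)
Record bistable (h : R -> R) (al ga l : R) : Prop := {
  bi_cont : forall s, continuous h s;
  bi_out : forall s, s <= 0 \/ 1 <= s -> h s = 0;
  bi_al : 0 < al < 1;
  bi_zero : h al = 0;
  bi_neg : forall s, 0 < s < al -> h s < 0;
  bi_pos : forall s, al < s < 1 -> 0 < h s;
  bi_derive : is_derive h al ga;
  bi_ga : 0 < ga;
  bi_tangent : forall s, 0 <= s <= 1 -> Rabs (h s) <= ga * Rabs (s - al);
  bi_l : 0 < l;
  bi_low : forall s, 0 <= s <= 1 -> - l * s <= h s;
  bi_up : forall s, 0 <= s <= 1 -> h s <= l * (1 - s)
}.

(** Reflection exchanges 0 and 1, and the change of sign restores the sign pattern; statements about
    one end or one side of [al] thus transfer to the other. *)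
Lemma bistable_flip h al ga l :
  bistable h al ga l -> bistable (fun s => - h (1 - s)) (1 - al) ga l.
Proof.
intros [Hc Ho Ha Hz Hn Hp Hd Hg Ht Hl Hlo Hup].
assert (Hs : forall s, is_derive (fun s => 1 - s) s (-1))
  by (intros s; auto_derive; [trivial|ring]).
split; try lra.
- intros s; apply (continuous_opp (fun s => h (1 - s))).
  apply (continuous_comp (fun s => 1 - s) h); [|apply Hc].
  apply (is_derive_continuous _ _ _ (Hs s)).
- intros s H; rewrite Ho; [ring|lra].
- replace (1 - (1 - al)) with al by ring; lra.
- intros s H; specialize (Hp (1 - s)); lra.
- intros s H; specialize (Hn (1 - s)); lra.
- assert (Hd' : is_derive h (1 - (1 - al)) ga).
  { now replace (1 - (1 - al)) with al by ring. }
  refine (is_derive_eq _ _ _ _ (is_derive_opp _ _ _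
    (is_derive_comp h _ _ _ _ Hd' (Hs (1 - al)))) _).
  unfold scal, opp; simpl; unfold mult; simpl; ring.
- intros s H; rewrite Rabs_Ropp.
  replace (s - (1 - al)) with (- ((1 - s) - al)) by ring.
  rewrite Rabs_Ropp; apply Ht; lra.
- intros s H; specialize (Hup (1 - s)); replace (1 - (1 - s)) with s in Hup by ring; lra.
- intros s H; specialize (Hlo (1 - s)); lra.
Qed.

Lemma bistable_bound h al ga l s : bistable h al ga l -> Rabs (h s) <= ga.
Proof.
intros B; assert (Hg := bi_ga _ _ _ _ B).
destruct (Rlt_le_dec 0 s) as [H0|H0]; [destruct (Rlt_le_dec s 1) as [H1|H1]|].
- apply Rle_trans with (1 := bi_tangent _ _ _ _ B s ltac:(lra)).
  rewrite <- (Rmult_1_r ga) at 2; apply Rmult_le_compat_l; [lra|].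
  generalize (bi_al _ _ _ _ B); intros; apply Rabs_le_between; lra.
- rewrite (bi_out _ _ _ _ B), Rabs_R0; lra.
- rewrite (bi_out _ _ _ _ B), Rabs_R0; lra.
Qed.

Definition potential (h : R -> R) (s : R) : R := RInt h 0 s.

Lemma is_derive_potential h (s : R) :
  (forall t, continuous h t) -> is_derive (potential h) s (h s).
Proof. apply is_derive_primitive. Qed.

Lemma continuous_potential h (s : R) :
  (forall t, continuous h t) -> continuous (potential h) s.
Proof. intros H; apply (is_derive_continuous _ _ _ (is_derive_potential h s H)). Qed.

Lemma potential_0 h : potential h 0 = 0.
Proof. exact (RInt_point (V := R_CompleteNormedModule) 0 h). Qed.

Lemma potential_lt_right h al ga l s t :
  bistable h al ga l -> al <= s < t -> t <= 1 -> potential h s < potential h t.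
Proof.
intros B H H1; apply increment_gt0; [lra| |].
- intros x _; apply continuous_potential, (bi_cont _ _ _ _ B).
- intros x Hx; exists (h x); split; [|apply (bi_pos _ _ _ _ B); lra].
  apply is_derive_potential, (bi_cont _ _ _ _ B).
Qed.

Lemma potential_gt_left h al ga l s t :
  bistable h al ga l -> 0 <= s < t -> t <= al -> potential h t < potential h s.
Proof.
intros B H H1; apply Ropp_lt_cancel.
apply (increment_gt0 (fun x => - potential h x)); [lra| |].
- intros x _; apply (continuous_opp (potential h)).
  apply continuous_potential, (bi_cont _ _ _ _ B).
- intros x Hx; exists (- h x); split.
  + apply (is_derive_opp (potential h)), is_derive_potential, (bi_cont _ _ _ _ B).
  + generalize (bi_neg _ _ _ _ B x); lra.
Qed.

Lemma potential_min h al ga l s :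
  bistable h al ga l -> 0 <= s <= 1 -> potential h al <= potential h s.
Proof.
intros B H; destruct (Rtotal_order s al) as [Hs|[->|Hs]]; [| lra|].
- apply Rlt_le, (potential_gt_left h al ga l); [exact B|lra|lra].
- apply Rlt_le, (potential_lt_right h al ga l); [exact B|lra|lra].
Qed.

(* [y] is the kinetic energy [kin v'] of a front, read as a function of [s = v]. *)
Definition backward_energy (h : R -> R) (P b : R) (y : R -> R) : Prop :=
  y 1 = 0 /\
  forall s, 0 <= s <= 1 -> is_derive y s (b * capped_slope P (y s) - h s).

(** Because [capped_slope] is at most [P], a solution for the speed [b] solves the problem for [b']
    up to an error [P |b' - b|]. Uniqueness and dependence on the speed both become instances of
    [approx_solution_close]. *)
Lemma backward_energy_approx h P b b' y :
  0 <= P -> backward_energy h P b y ->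
  approx_solution (fun t => h (1 - t)) (fun u => b' * capped_slope P u)
    (P * Rabs (b' - b)) (fun t => y (1 - t)).
Proof.
intros HP [y1 dy]; split; [now rewrite Rminus_0_r|]; intros t Ht.
exists (h (1 - t) - b * capped_slope P (y (1 - t))); split.
- assert (Hs : is_derive (fun s => 1 - s) t (-1)) by (auto_derive; [trivial|ring]).
  refine (is_derive_eq _ _ _ _
    (is_derive_comp y _ _ _ _ (dy (1 - t) ltac:(lra)) Hs) _).
  unfold scal; simpl; unfold mult; simpl; ring.
- set (u := capped_slope P (y (1 - t))).
  replace (h (1 - t) - b * u - (h (1 - t) - b' * u)) with (u * (b' - b)) by ring.
  assert (Hu : 0 <= u <= P) by now apply capped_slope_range.
  rewrite Rabs_mult, (Rabs_pos_eq u) by lra.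
  apply Rmult_le_compat_r; [apply Rabs_pos|lra].
Qed.

Lemma backward_energy_close h P b1 b2 y1 y2 :
  0 <= P -> 0 <= b1 -> backward_energy h P b1 y1 -> backward_energy h P b2 y2 ->
  Rabs (y1 0 - y2 0) <= P * Rabs (b1 - b2).
Proof.
intros HP Hb H1 H2.
assert (M : forall x y, x <= y -> b1 * capped_slope P x <= b1 * capped_slope P y).
{ intros x y Hxy; apply Rmult_le_compat_l; [exact Hb|now apply capped_slope_le]. }
assert (A1 := backward_energy_approx h P b1 b1 y1 HP H1).
assert (A2 := backward_energy_approx h P b2 b1 y2 HP H2).
assert (N : forall z, 0 <= P * Rabs z).
{ intros z; apply Rmult_le_pos; [exact HP|apply Rabs_pos]. }
assert (C1 := approx_solution_close _ _ _ _ _ _ 1 M (N _) (N _) A1 A2 ltac:(lra)).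
assert (C2 := approx_solution_close _ _ _ _ _ _ 1 M (N _) (N _) A2 A1 ltac:(lra)).
simpl in C1, C2; rewrite !Rminus_diag, Rabs_R0 in C1, C2.
apply Rabs_le_between; lra.
Qed.

Lemma backward_energy_exists h al ga l P b :
  bistable h al ga l -> 0 <= P -> 0 <= b -> exists y, backward_energy h P b y.
Proof.
intros B HP Hb.
assert (Hs : forall t : R, is_derive (fun s => 1 - s) t (-1))
  by (intros t; auto_derive; [trivial|ring]).
destruct (dissipative_solution_exists (fun t => h (1 - t))
  (fun u => b * capped_slope P u) (ga + b * P)) as [y [y0 dy]].
- intros t; apply (continuous_comp (fun s => 1 - s) h); [|apply (bi_cont _ _ _ _ B)].
  apply (is_derive_continuous _ _ _ (Hs t)).
- intros e He.
  destruct (capped_slope_uniformly_continuous P (e / (b + 1))) as [d [Hd H]].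
  { apply Rdiv_lt_0_compat; lra. }
  exists d; split; [exact Hd|]; intros x y Hxy; specialize (H x y Hxy).
  rewrite <- Rmult_minus_distr_l, Rabs_mult, (Rabs_pos_eq b) by exact Hb.
  apply Rle_lt_trans with (b * (e / (b + 1))); [apply Rmult_le_compat_l; lra|].
  replace (b * (e / (b + 1))) with (e - e / (b + 1)) by (field; lra).
  assert (0 < e / (b + 1)) by (apply Rdiv_lt_0_compat; lra); lra.
- intros x y Hxy; apply Rmult_le_compat_l; [exact Hb|now apply capped_slope_le].
- intros x u; apply Rle_trans with (1 := Rabs_triang _ _); apply Rplus_le_compat.
  + now apply (bistable_bound h al ga l).
  + rewrite Rabs_Ropp; destruct (capped_slope_range P u HP).
    rewrite Rabs_pos_eq by now apply Rmult_le_pos.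
    now apply Rmult_le_compat_l.
- exists (fun s => y (1 - s)); split; [now rewrite Rminus_diag|]; intros s Hs01.
  refine (is_derive_eq _ _ _ _
    (is_derive_comp y _ _ _ _ (dy (1 - s) ltac:(lra)) (Hs s)) _).
  replace (1 - (1 - s)) with s by ring.
  unfold scal; simpl; unfold mult; simpl; ring.
Qed.

Lemma backward_energy_continuous h P b y (s : R) :
  backward_energy h P b y -> 0 <= s <= 1 -> continuous y s.
Proof. intros [_ dy] Hs; apply (is_derive_continuous _ _ _ (dy s Hs)). Qed.

(* The line [p = (b / 2) (s - al)] solves the equation linearized at [al]
   up to the sign of [ga - b ^ 2 / 4]. *)
Lemma backward_energy_below_line h al ga l P b y s :
  bistable h al ga l -> 0 <= b -> 4 * ga <= b ^ 2 -> b / 2 <= P ->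
  backward_energy h P b y -> al <= s <= 1 -> y s <= kin (b / 2 * (s - al)).
Proof.
intros B Hb Hgb HbP Hy Hs; assert (Hal := bi_al _ _ _ _ B).
apply Rnot_lt_le; intros Hlt.
set (Y := fun s => kin (b / 2 * (s - al))).
assert (dY : forall x : R, is_derive Y x
  (b / 2 * (b / 2 * (x - al) / curv (b / 2 * (x - al))))).
{ intros x.
  assert (L : is_derive (fun s => b / 2 * (s - al)) x (b / 2))
    by (auto_derive; [trivial|field]).
  exact (is_derive_comp kin _ x _ _ (is_derive_kin _) L). }
assert (D : Y 1 - y 1 <= Y s - y s + 0 * (1 - s)).
{ apply (barrier (fun x => Y x - y x) s 1); try lra.
  - intros x Hx; apply (continuous_minus Y y).
    + apply (is_derive_continuous _ _ _ (dY x)).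
    + apply (backward_energy_continuous h P b y); [exact Hy|lra].
  - unfold Y; lra.
  - unfold Y; lra.
  - intros x Hx Hneg.
    eexists; split.
    { exact (is_derive_minus Y y x _ _ (dY x) (proj2 Hy x ltac:(lra))). }
    unfold minus, plus, opp; simpl.
    set (p := b / 2 * (x - al)).
    assert (Hp : 0 <= p <= P).
    { unfold p; split; [apply Rmult_le_pos; lra|].
      apply Rle_trans with (b / 2 * 1); [apply Rmult_le_compat_l; lra|lra]. }
    assert (HR : p <= capped_slope P (y x)).
    { rewrite <- (capped_slope_kin P p Hp) at 1; apply capped_slope_le.
      change (kin p) with (Y x); lra. }
    assert (Hc : p / curv p <= p).
    { apply Rle_div_l; [generalize (curv_ge1 p); lra|].
      generalize (curv_ge1 p); nra. }
    assert (Hh : h x <= ga * (x - al)).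
    { eapply Rle_trans; [apply Rle_abs|].
      eapply Rle_trans; [apply (bi_tangent _ _ _ _ B); lra|].
      rewrite Rabs_pos_eq; lra. }
    (* Where [Y < y], the derivative of [Y - y] is at most [b p / 2 - b p + ga (x - al) = (ga - b ^
       2 / 4) (x - al) <= 0]. A negative difference would then persist up to [s = 1], where [y]
       vanishes. *)
    assert (b * p <= b * capped_slope P (y x)) by (apply Rmult_le_compat_l; lra).
    assert (b / 2 * (p / curv p) <= b / 2 * p) by (apply Rmult_le_compat_l; lra).
    assert (4 * ga * (x - al) <= b ^ 2 * (x - al)) by (apply Rmult_le_compat_r; lra).
    assert (b / 2 * p = b ^ 2 * (x - al) / 4) by (unfold p; field).
    assert (b * p = b ^ 2 * (x - al) / 2) by (unfold p; field).
    lra. }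
destruct Hy as [y1 _].
assert (0 <= Y 1) by apply kin_range.
unfold Y in D at 2; lra.
Qed.

(** Below zero the capped slope vanishes and [y' = - h < 0] to the right of [al], so [y] could not
    climb back to 0 at [s = 1]. *)
Lemma backward_energy_nonneg h al ga l P b y s :
  bistable h al ga l -> backward_energy h P b y -> al <= s <= 1 -> 0 <= y s.
Proof.
intros B Hy Hs; apply Rnot_lt_le; intros Hlt.
assert (D : y 1 <= y s + 0 * (1 - s)).
{ apply (barrier y s 1); try lra.
  - intros x Hx; apply (backward_energy_continuous h P b y); [exact Hy|].
    generalize (bi_al _ _ _ _ B); lra.
  - intros x Hx Hneg.
    eexists; split; [apply Hy; generalize (bi_al _ _ _ _ B); lra|].
    rewrite capped_slope_nonpos by lra.
    generalize (bi_pos _ _ _ _ B x); lra. }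
destruct Hy as [y1 _]; lra.
Qed.

(** An interior zero would be a minimum, yet the derivative there is [- h s], which is nonzero. *)
Lemma backward_energy_pos_right h al ga l P b y s :
  bistable h al ga l -> backward_energy h P b y -> al < s < 1 -> 0 < y s.
Proof.
intros B Hy Hs; assert (Hal := bi_al _ _ _ _ B).
destruct (backward_energy_nonneg h al ga l P b y s B Hy) as [H|H]; [lra|exact H|exfalso].
assert (E : b * capped_slope P (y s) - h s = 0).
{ apply (is_derive_at_min y s _ (Rmin (s - al) (1 - s))).
  - apply Rmin_glb_lt; lra.
  - apply Hy; lra.
  - intros t Ht; rewrite <- H.
    apply (backward_energy_nonneg h al ga l P b); [exact B|exact Hy|].
    generalize (Rmin_l (s - al) (1 - s)) (Rmin_r (s - al) (1 - s)).
    apply Rabs_lt_between in Ht; lra. }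
rewrite <- H, capped_slope_nonpos in E by lra.
generalize (bi_pos _ _ _ _ B s); lra.
Qed.

Lemma backward_energy_incr_left h al ga l P b y s t :
  bistable h al ga l -> 0 <= P -> 0 <= b -> backward_energy h P b y ->
  0 <= s < t -> t <= al -> y s < y t.
Proof.
intros B HP Hb Hy Hs Ht; assert (Hal := bi_al _ _ _ _ B).
apply increment_gt0; [lra| |].
- intros x Hx; apply (backward_energy_continuous h P b y); [exact Hy|lra].
- intros x Hx; eexists; split; [apply Hy; lra|].
  assert (0 <= b * capped_slope P (y x)).
  { apply Rmult_le_pos; [exact Hb|apply slope_ge0]. }
  generalize (bi_neg _ _ _ _ B x); lra.
Qed.

(** From [y' >= - h >= - l (1 - s)], integrated from [s] to 1. *)
Lemma backward_energy_quadratic h al ga l P b y s :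
  bistable h al ga l -> 0 <= b -> backward_energy h P b y -> 0 <= s <= 1 ->
  y s <= l * (1 - s) ^ 2 / 2.
Proof.
intros B Hb Hy Hs.
assert (I : 0 * (1 - s) <= (y 1 - l * (1 - 1) ^ 2 / 2) - (y s - l * (1 - s) ^ 2 / 2)).
{ assert (dq : forall x : R, 0 <= x <= 1 ->
    is_derive (fun x => y x - l * (1 - x) ^ 2 / 2) x
      (b * capped_slope P (y x) - h x + l * (1 - x))).
  { intros x Hx.
    assert (Q : is_derive (fun x => l * (1 - x) ^ 2 / 2) x (- (l * (1 - x))))
      by (auto_derive; [trivial|field]).
    refine (is_derive_eq _ _ _ _ (is_derive_minus y _ x _ _ (proj2 Hy x Hx) Q) _).
    unfold minus, plus, opp; simpl; ring. }
  apply (increment_ge (fun x => y x - l * (1 - x) ^ 2 / 2)); [lra| |].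
  - intros x Hx; apply (is_derive_continuous _ _ _ (dq x ltac:(lra))).
  - intros x Hx; eexists; split; [apply dq; lra|].
    generalize (bi_up _ _ _ _ B x ltac:(lra)).
    assert (0 <= b * capped_slope P (y x)).
    { apply Rmult_le_pos; [exact Hb|apply slope_ge0]. }
    lra. }
destruct Hy as [y1 _]; rewrite y1 in I.
replace (l * (1 - 1) ^ 2 / 2) with 0 in I by field; lra.
Qed.

(** * Orbits in the phase plane *)

(** [F] is [v'] as a function of [s = v] along a front from [q] to 1. The two linear bounds make the
    integral of [1 / F] diverge at both ends, so that the front lives on all of R. *)
Record orbit (h : R -> R) (b q C : R) (F : R -> R) : Prop := {
  orbit_pos : forall s, q < s < 1 -> 0 < F s;
  orbit_derive : forall s, q < s < 1 -> is_derive F s (curv (F s) * (b - h s / F s));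
  orbit_left : forall s, q < s < 1 -> F s <= C * (s - q);
  orbit_right : forall s, q < s < 1 -> F s <= C * (1 - s)
}.

Lemma orbit_of_backward_energy h al ga l P b y q C :
  bistable h al ga l -> 0 <= b -> 0 <= q -> backward_energy h P b y ->
  (forall s, q < s < 1 -> 0 < y s <= kin P) ->
  (forall s, q < s < 1 -> slope (y s) <= C * (s - q)) ->
  exists C', orbit h b q C' (fun s => slope (y s)).
Proof.
intros B Hb Hq Hy Hpos Hleft.
generalize (kin_range P); intros HP.
set (C2 := sqrt l / (1 - kin P)).
exists (Rmax C C2); split.
- intros s Hs; apply slope_gt0; generalize (Hpos s Hs); lra.
- intros s Hs; generalize (Hpos s Hs); intros Hys.
  generalize (slope_gt0 (y s) ltac:(lra)); intros Hp.
  refine (is_derive_eq _ _ _ _ (is_derive_comp slope y s _ _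
    (is_derive_slope (y s) ltac:(lra)) (proj2 Hy s ltac:(lra))) _).
  rewrite capped_slope_id by lra.
  unfold scal; simpl; unfold mult; simpl; field; lra.
- intros s Hs; apply Rle_trans with (1 := Hleft s Hs).
  apply Rmult_le_compat_r; [lra|apply Rmax_l].
- intros s Hs; generalize (Hpos s Hs); intros Hys.
  apply Rle_trans with (C2 * (1 - s)); [|apply Rmult_le_compat_r; [lra|apply Rmax_r]].
  apply slope_le_quadratic; try lra.
  + generalize (bi_l _ _ _ _ B); lra.
  + apply (backward_energy_quadratic h al ga l P b); [exact B|exact Hb|exact Hy|lra].
Qed.

Lemma monostable_orbit_exists h al ga l b :
  bistable h al ga l -> 0 <= b -> 4 * ga <= b ^ 2 -> exists C F, orbit h b al C F.
Proof.
intros B Hb Hgb; assert (Hal := bi_al _ _ _ _ B).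
(* The cap [b / 2] bounds the barrier line on [al, 1], hence it is never active; the same line gives
   the linear bound at [al]. *)
destruct (backward_energy_exists h al ga l (b / 2) b B) as [y Hy]; [lra|lra|].
assert (Hline : forall s, al <= s <= 1 -> y s <= kin (b / 2 * (s - al))).
{ intros s Hs; apply (backward_energy_below_line h al ga l (b / 2) b); auto; lra. }
assert (Hlin : forall s, al < s < 1 -> 0 <= b / 2 * (s - al) <= b / 2).
{ intros s Hs; split; [apply Rmult_le_pos; lra|].
  rewrite <- (Rmult_1_r (b / 2)) at 2; apply Rmult_le_compat_l; lra. }
destruct (orbit_of_backward_energy h al ga l (b / 2) b y al (b / 2)) as [C HC];
  auto; try lra.
- intros s Hs; split.
  + now apply (backward_energy_pos_right h al ga l (b / 2) b).
  + apply Rle_trans with (1 := Hline s ltac:(lra)), kin_le; now apply Hlin.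
- intros s Hs; destruct (Hlin s Hs) as [H1 H2].
  rewrite <- (slope_kin (b / 2 * (s - al)) H1) at 1.
  apply slope_le; [split; [|apply Hline; lra]|apply kin_range].
  now apply Rlt_le, (backward_energy_pos_right h al ga l (b / 2) b).
- now exists C, (fun s => slope (y s)).
Qed.

(** The energy equation has the wrong monotonicity for a bound starting from [s = 0]. For the flux
    the growth rate is [b - h / F], and [h >= - l s] keeps it below [b + l] as long as [F >= s]. *)
Lemma backward_energy_linear_at_0 h al ga l P b y :
  bistable h al ga l -> 0 <= P -> 0 <= b -> backward_energy h P b y -> y 0 = 0 ->
  (forall s, 0 < s < 1 -> 0 < y s <= kin P) ->
  exists C, forall s, 0 < s < 1 -> slope (y s) <= C * s.
Proof.
intros B HP Hb Hy y0 Hpos; assert (Hal := bi_al _ _ _ _ B); assert (Hl := bi_l _ _ _ _ B).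
generalize (kin_range P); intros HkP.
set (F := fun s => slope (y s)).
assert (HF : forall s, 0 < s < 1 -> 0 < F s).
{ intros s Hs; apply slope_gt0; generalize (Hpos s Hs); lra. }
(* The summand 1 ensures [m >= 1]: then [flux F > m x] forces [F >= x], which is what bounds
   [- h / F] by [l]. *)
set (m := b + l + 1).
assert (Hflux : forall s, 0 <= s <= al -> flux (F s) - m * s <= 0 * (s - 0)).
{ apply (barrier_backward (fun s => flux (F s) - m * s)); try lra.
  - intros x Hx.
    apply (continuous_minus (fun s => flux (F s)) (fun s => m * s)).
    + apply (continuous_comp F flux);
        [|apply (is_derive_continuous _ _ _ (is_derive_flux _))].
      apply (continuous_comp y slope).
      * apply (backward_energy_continuous h P b); [exact Hy|lra].
      * apply continuous_slope; destruct (Rle_lt_or_eq_dec 0 x) as [Hx0|<-]; try lra.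
        generalize (Hpos x ltac:(lra)); lra.
    + apply (is_derive_continuous (fun s => m * s) x m); auto_derive; [trivial|ring].
  - unfold F; rewrite y0, slope_0, flux_0; lra.
  - intros x Hx HD; exists (b - h x / F x - m); split.
    + assert (dF : is_derive F x (curv (F x) * (b - h x / F x))).
      { generalize (Hpos x ltac:(lra)) (HF x ltac:(lra)); intros Hyx HFx.
        refine (is_derive_eq _ _ _ _ (is_derive_comp slope y x _ _
          (is_derive_slope (y x) ltac:(lra)) (proj2 Hy x ltac:(lra))) _).
        rewrite capped_slope_id by lra.
        unfold scal; simpl; unfold mult; simpl; fold (F x); field; lra. }
      assert (dm : is_derive (fun s => m * s) x m) by (auto_derive; [trivial|ring]).
      refine (is_derive_eq _ _ _ _ (is_derive_minus _ _ _ _ _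
        (is_derive_comp flux F x _ _ (is_derive_flux _) dF) dm) _).
      unfold scal, minus, plus, opp; simpl; unfold mult; simpl.
      generalize (HF x ltac:(lra)) (curv_ge1 (F x)); intros HFx Hcurv.
      field; split; lra.
    + generalize (HF x ltac:(lra)); intros HFx.
      assert (Hge : flux (F x) <= F x).
      { unfold flux; generalize (sqrt_1p2_ge1 (F x)); intros S1.
        apply Rle_div_l; [lra|]; nra. }
      assert (Hx1 : x <= F x).
      { assert (1 * x <= m * x) by (apply Rmult_le_compat_r; unfold m; lra); lra. }
      assert (- h x / F x <= l).
      { apply Rle_div_l; [lra|].
        generalize (bi_low _ _ _ _ B x ltac:(lra)); intros Hlow.
        assert (l * x <= l * F x) by (apply Rmult_le_compat_l; lra); lra. }
      unfold Rdiv in *; unfold m; lra. }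
(* Left of [al] the flux bound is converted by [slope y = flux / (1 - y)]; right of [al] the cap [P]
   is at most [(P / al) s]. *)
exists (Rmax (m / (1 - kin P)) (P / al)); intros s Hs.
generalize (Hpos s Hs); intros Hys.
destruct (Rle_lt_dec s al) as [Hsa|Hsa].
- apply Rle_trans with (m / (1 - kin P) * s);
    [|apply Rmult_le_compat_r; [lra|apply Rmax_l]].
  generalize (Hflux s ltac:(lra)); intros Hf.
  unfold flux, F in Hf; rewrite sqrt_1_slope in Hf by lra.
  unfold Rdiv in Hf; rewrite Rinv_inv in Hf.
  replace (m / (1 - kin P) * s) with (m * s / (1 - kin P)) by (field; lra).
  apply Rle_div_r; [lra|].
  apply Rle_trans with (slope (y s) * (1 - y s)); [|lra].
  apply Rmult_le_compat_l; [apply slope_ge0|lra].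
- apply Rle_trans with (P / al * s);
    [|apply Rmult_le_compat_r; [lra|apply Rmax_r]].
  apply Rle_trans with P.
  + rewrite <- (slope_kin P HP) at 1; apply slope_le; lra.
  + replace (P / al * s) with (P * s / al) by (field; lra).
    apply Rle_div_r; [lra|]; apply Rmult_le_compat_l; lra.
Qed.

(** * Shooting for the speed of a front from 0 to 1 *)

(** While [y + G < c = k + G(al)], the minimality of [G(al)] gives [y < k], so [y + G] grows at rate
    at most [b * slope k]. If both alternatives failed, it would stay below [c] on [0,1] and end at
    most at [b * slope k < G(1)]. The bound does not involve [P], so that [P] can be chosen from
    it. *)
Lemma backward_energy_speed_lower_bound h al ga l P b y k :
  bistable h al ga l -> 0 <= b -> backward_energy h P b y -> y 0 = 0 ->
  - potential h al < k -> 0 <= k <= kin P ->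
  k + potential h al <= b * slope k \/ potential h 1 <= b * slope k.
Proof.
intros B Hb Hy y0 Hk HkP; assert (Hal := bi_al _ _ _ _ B).
destruct (Rle_lt_dec (k + potential h al) (b * slope k)) as [H1|H1]; [now left|].
destruct (Rle_lt_dec (potential h 1) (b * slope k)) as [H2|H2]; [now right|exfalso].
set (c := k + potential h al).
assert (Hs0 : 0 <= b * slope k) by (apply Rmult_le_pos; [exact Hb|apply slope_ge0]).
assert (D : y 1 + potential h 1 - c
            <= y 0 + potential h 0 - c + b * slope k * (1 - 0)).
{ apply (barrier (fun s => y s + potential h s - c) 0 1); try lra.
  - intros x Hx; apply (continuous_minus (fun s => y s + potential h s));
      [|apply continuous_const].
    apply (continuous_plus y (potential h)).
    + apply (backward_energy_continuous h P b); [exact Hy|lra].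
    + apply continuous_potential, (bi_cont _ _ _ _ B).
  - rewrite y0, potential_0; unfold c; lra.
  - rewrite y0, potential_0; unfold c; lra.
  - intros x Hx HD; exists (b * capped_slope P (y x)); split.
    + assert (dc : is_derive (fun _ => c) x 0) by apply (is_derive_const c x).
      refine (is_derive_eq _ _ _ _ (is_derive_minus _ _ _ _ _
        (is_derive_plus y (potential h) x _ _ (proj2 Hy x ltac:(lra))
          (is_derive_potential h x (bi_cont _ _ _ _ B))) dc) _).
      unfold minus, plus, opp; simpl; ring.
    + apply Rmult_le_compat_l; [exact Hb|].
      rewrite <- (capped_slope_id P k) by lra; apply capped_slope_le.
      generalize (potential_min h al ga l x B ltac:(lra)); unfold c in HD; lra. }
destruct Hy as [y1 _]; rewrite y1, y0, potential_0 in D; lra.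
Qed.

(** Above the cap [y' = b P - h >= b P - ga >= 0], so [y] could not return to 0 at [s = 1]. *)
Lemma backward_energy_below_cap h al ga l P b y s :
  bistable h al ga l -> 0 <= P -> ga <= b * P -> backward_energy h P b y ->
  0 <= s <= 1 -> y s <= kin P.
Proof.
intros B HP HbP Hy Hs; apply Rnot_lt_le; intros Hlt.
generalize (kin_range P); intros HkP.
assert (D : kin P - y 1 <= kin P - y s + 0 * (1 - s)).
{ apply (barrier (fun x => kin P - y x) s 1); try lra.
  - intros x Hx; apply (continuous_minus (fun _ => kin P) y); [apply continuous_const|].
    apply (backward_energy_continuous h P b); [exact Hy|lra].
  - intros x Hx HD; exists (0 - (b * capped_slope P (y x) - h x)); split.
    + assert (dc : is_derive (fun _ => kin P) x 0) by apply (is_derive_const (kin P) x).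
      exact (is_derive_minus _ _ _ _ _ dc (proj2 Hy x ltac:(lra))).
    + rewrite capped_slope_ge by lra.
      generalize (bistable_bound h al ga l x B); intros Hh.
      apply Rabs_le_between in Hh; lra. }
destruct Hy as [y1 _]; rewrite y1 in D; lra.
Qed.

(** Otherwise the line gives [y al <= kin 0 = 0], and [y] is strictly increasing on [0, al], so
    [y 0 < 0]. *)
Lemma backward_energy_end_speed h al ga l P b y :
  bistable h al ga l -> 0 <= P -> 0 <= b -> b / 2 <= P -> backward_energy h P b y ->
  0 <= y 0 -> b ^ 2 < 4 * ga.
Proof.
intros B HP Hb HbP Hy H0; assert (Hal := bi_al _ _ _ _ B).
apply Rnot_le_lt; intros Hgb.
assert (H1 := backward_energy_below_line h al ga l P b y al B Hb Hgb HbP Hy ltac:(lra)).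
assert (H2 := backward_energy_incr_left h al ga l P b y 0 al B HP Hb Hy ltac:(lra) ltac:(lra)).
replace (b / 2 * (al - al)) with 0 in H1 by ring; rewrite kin_0 in H1; lra.
Qed.

Lemma backward_energy_zero_speed h al ga l P y :
  bistable h al ga l -> backward_energy h P 0 y -> y 0 = potential h 1.
Proof.
intros B Hy.
assert (dE : forall x : R, 0 <= x <= 1 -> is_derive (fun s => y s + potential h s) x 0).
{ intros x Hx; refine (is_derive_eq _ _ _ _ (is_derive_plus y (potential h) x _ _
    (proj2 Hy x Hx) (is_derive_potential h x (bi_cont _ _ _ _ B))) _).
  unfold plus; simpl; ring. }
assert (CE : forall x, 0 <= x <= 1 -> continuous (fun s => y s + potential h s) x).
{ intros x Hx; apply (is_derive_continuous _ _ _ (dE x Hx)). }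
assert (I1 : (y 1 + potential h 1) - (y 0 + potential h 0) <= 0 * (1 - 0)).
{ apply (increment_le (fun s => y s + potential h s)); [lra|exact CE|].
  intros x Hx; exists 0; split; [apply dE; lra|lra]. }
assert (I2 : 0 * (1 - 0) <= (y 1 + potential h 1) - (y 0 + potential h 0)).
{ apply (increment_ge (fun s => y s + potential h s)); [lra|exact CE|].
  intros x Hx; exists 0; split; [apply dE; lra|lra]. }
destruct Hy as [y1 _]; rewrite y1, potential_0 in I1, I2; lra.
Qed.

(* Shooting in the speed: the energy integrated backward from [s = 1] arrives
   at [s = 0] with a positive value for [b = 0] and with a nonpositive one for
   [b = 2 sqrt ga]. *)
Lemma shooting h al ga l P :
  bistable h al ga l -> 0 < potential h 1 -> sqrt ga <= P ->
  exists b y, 0 < b < 2 * sqrt ga /\ backward_energy h P b y /\ y 0 = 0.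
Proof.
intros B HI HP; assert (Hg := bi_ga _ _ _ _ B).
assert (Hsg : 0 < sqrt ga) by (now apply sqrt_lt_R0).
assert (Hsq : sqrt ga * sqrt ga = ga) by (apply sqrt_sqrt; lra).
assert (HP0 : 0 <= P) by lra.
(* Negative speeds are replaced by 0, since the intermediate value theorem is applied to a function
   continuous on all of R. *)
assert (Hpos : forall b, 0 <= Rmax 0 b) by (intros b; apply Rmax_l).
set (Y := fun b => proj1_sig (constructive_indefinite_description _
  (backward_energy_exists h al ga l P (Rmax 0 b) B HP0 (Hpos b)))).
assert (HY : forall b, backward_energy h P (Rmax 0 b) (Y b)).
{ intros b; exact (proj2_sig (constructive_indefinite_description _
  (backward_energy_exists h al ga l P (Rmax 0 b) B HP0 (Hpos b)))). }
assert (CY : continuity (fun b => Y b 0)).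
{ intros b; apply continuous_continuity_pt, continuous_eps; intros e He.
  exists (e / (P + 1)); split; [apply Rdiv_lt_0_compat; lra|]; intros t Ht.
  apply Rle_lt_trans with (P * Rabs (t - b)).
  - apply Rle_trans with (1 := backward_energy_close h P _ _ _ _ HP0 (Hpos t) (HY t) (HY b)).
    apply Rmult_le_compat_l; [exact HP0|].
    unfold Rmax; repeat destruct (Rle_dec 0 _); unfold Rabs; repeat destruct (Rcase_abs _); lra.
  - apply Rlt_div_r in Ht; [|lra].
    generalize (Rabs_pos (t - b)); intros; lra. }
assert (Y0 : Y 0 0 = potential h 1).
{ apply (backward_energy_zero_speed h al ga l P); [exact B|].
  generalize (HY 0); rewrite Rmax_left by lra; trivial. }
assert (Y1 : Y (2 * sqrt ga) 0 < 0).
{ apply Rnot_le_lt; intros H0.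
  assert (Hb := HY (2 * sqrt ga)); rewrite Rmax_right in Hb by lra.
  assert (H2 := backward_energy_end_speed h al ga l P (2 * sqrt ga) _ B HP0 ltac:(lra) ltac:(lra) Hb H0).
  replace ((2 * sqrt ga) ^ 2) with (4 * (sqrt ga * sqrt ga)) in H2 by ring; lra. }
destruct (IVT_gen (fun b => Y b 0) 0 (2 * sqrt ga) 0 CY) as [b [Hb Eb]].
{ rewrite Rmin_right, Rmax_left; lra. }
rewrite Rmin_left, Rmax_right in Hb by lra.
exists b, (Y b); split; [|split; [|exact Eb]].
- split.
  + destruct (Rle_lt_or_eq_dec 0 b) as [H|H]; [lra|exact H|subst b; lra].
  + destruct (Rle_lt_or_eq_dec b (2 * sqrt ga)) as [H|H]; [lra|exact H|subst b; lra].
- generalize (HY b); rewrite Rmax_right by lra; trivial.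
Qed.

Lemma bistable_orbit_exists h al ga l :
  bistable h al ga l -> 0 < potential h 1 -> - potential h al < 1 ->
  exists b C F, 0 < b < 2 * sqrt ga /\ orbit h b 0 C F.
Proof.
intros B HI Hk1; assert (Hg := bi_ga _ _ _ _ B); assert (Hal := bi_al _ _ _ _ B).
assert (Hk0 : potential h al < 0).
{ rewrite <- (potential_0 h); apply (potential_gt_left h al ga l); [exact B|lra|lra]. }
(* The midpoint of [- potential h al] and 1; the threshold on [eps] is exactly what leaves room for
   such an energy below 1. *)
set (k := (1 - potential h al) / 2).
assert (Hk : - potential h al < k < 1) by (unfold k; lra).
assert (Hsk : 0 < slope k) by (apply slope_gt0; lra).
set (m := Rmin (k + potential h al) (potential h 1)).
assert (Hm : 0 < m) by (apply Rmin_glb_lt; lra).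
(* The three entries give [k <= kin P], the cap required by [shooting], and [ga <= b P] as soon as
   [m <= b * slope k]. *)
set (P := Rmax (slope k) (Rmax (sqrt ga) (ga * slope k / m))).
assert (HP1 : slope k <= P) by apply Rmax_l.
assert (HP2 : sqrt ga <= P) by (eapply Rle_trans; [apply Rmax_l|apply Rmax_r]).
assert (HP3 : ga * slope k / m <= P) by (eapply Rle_trans; [apply Rmax_r|apply Rmax_r]).
destruct (shooting h al ga l P B HI HP2) as [b [y [Hb [Hy y0]]]].
assert (Hbm : m <= b * slope k).
{ destruct (backward_energy_speed_lower_bound h al ga l P b y k) as [H|H]; auto; try lra.
  - split; [lra|]; rewrite <- (kin_slope k) by lra; apply kin_le; lra.
  - apply Rle_trans with (2 := H), Rmin_l.
  - apply Rle_trans with (2 := H), Rmin_r. }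
assert (Hcap : forall s, 0 <= s <= 1 -> y s <= kin P).
{ intros s Hs; apply (backward_energy_below_cap h al ga l P b); auto; [lra|].
  apply Rle_trans with (b * (ga * slope k / m)); [|apply Rmult_le_compat_l; lra].
  replace (b * (ga * slope k / m)) with (ga * (b * slope k) / m) by (field; lra).
  apply Rle_div_r; [exact Hm|]; apply Rmult_le_compat_l; lra. }
assert (Hpos : forall s, 0 < s < 1 -> 0 < y s <= kin P).
{ intros s Hs; split; [|apply Hcap; lra].
  destruct (Rle_lt_dec s al) as [H|H].
  - rewrite <- y0; apply (backward_energy_incr_left h al ga l P b); auto; lra.
  - apply (backward_energy_pos_right h al ga l P b); auto; lra. }
destruct (backward_energy_linear_at_0 h al ga l P b y) as [C HC]; auto; try lra.
destruct (orbit_of_backward_energy h al ga l P b y 0 C) as [C' HO]; auto; try lra.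
- intros s Hs; rewrite Rminus_0_r; now apply HC.
- now exists b, C', (fun s => slope (y s)).
Qed.

(** * From orbits to fronts *)

Definition travel_time (F : R -> R) (m s : R) : R := RInt (fun x => / F x) m s.

Lemma is_derive_travel_time (F : R -> R) a c m (s : R) :
  (forall x : R, a < x < c -> continuous F x) -> (forall x, a < x < c -> 0 < F x) ->
  a < m < c -> a < s < c -> is_derive (travel_time F m) s (/ F s).
Proof.
intros CF PF Hm Hs.
assert (Ci : forall x : R, a < x < c -> continuous (fun x => / F x) x).
{ intros x Hx; apply (continuous_comp F Rinv); [now apply CF|].
  apply continuous_Rinv; generalize (PF x Hx); lra. }
apply (is_derive_RInt (fun x => / F x) (travel_time F m) m s); [|now apply Ci].
assert (Hd : 0 < Rmin (s - a) (c - s)) by (apply Rmin_glb_lt; lra).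
exists (mkposreal _ Hd); intros t Ht.
assert (Ht' : Rabs (t - s) < Rmin (s - a) (c - s)) by exact Ht.
apply Rabs_lt_between in Ht'.
generalize (Rmin_l (s - a) (c - s)) (Rmin_r (s - a) (c - s)); intros R1 R2.
apply (RInt_correct (fun x => / F x)), ex_RInt_continuous; intros x Hx; apply Ci.
split.
- apply Rlt_le_trans with (2 := proj1 Hx), Rmin_glb_lt; lra.
- apply Rle_lt_trans with (1 := proj2 Hx), Rmax_lub_lt; lra.
Qed.

(** Comparison of [1 / F] with [1 / (C (c - x))] and [1 / (C (x - a))], whose primitives are
    logarithms and unbounded at the ends. *)
Lemma travel_time_surjective (F : R -> R) a c C z :
  a < c -> 0 < C -> (forall x : R, a < x < c -> continuous F x) ->
  (forall x, a < x < c -> 0 < F x) ->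
  (forall x, a < x < c -> F x <= C * (x - a)) ->
  (forall x, a < x < c -> F x <= C * (c - x)) ->
  exists s, a < s < c /\ travel_time F ((a + c) / 2) s = z.
Proof.
intros Hac HC CF PF Fa Fc; set (m := (a + c) / 2).
assert (Hm : a < m < c) by (unfold m; lra).
set (Z := travel_time F m).
assert (dZ : forall s, a < s < c -> is_derive Z s (/ F s)).
{ intros s Hs; now apply (is_derive_travel_time F a c). }
assert (Zm : Z m = 0) by exact (RInt_point (V := R_CompleteNormedModule) m _).
set (A := Rabs z + 1).
assert (HA : 0 < A) by (unfold A; generalize (Rabs_pos z); lra).
(* At relative distance [e] from an endpoint the logarithm divided by [C] has changed by exactly
   [A], so [Z s1 <= - A < z < A <= Z s2]. Since [m] is the midpoint, one [e] serves both ends. *)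
set (e := exp (- (C * A))).
assert (He : 0 < e < 1).
{ split; [apply exp_pos|]; rewrite <- exp_0; apply exp_increasing.
  assert (0 < C * A) by (now apply Rmult_lt_0_compat); lra. }
assert (Hln : ln e = - (C * A)) by apply ln_exp.
assert (Hca : 0 < (c - m) * e < c - m).
{ split; [apply Rmult_lt_0_compat; lra|].
  rewrite <- (Rmult_1_r (c - m)) at 2; apply Rmult_lt_compat_l; lra. }
set (s1 := a + (c - m) * e); set (s2 := c - (c - m) * e).
assert (Hs1 : a < s1 < m) by (unfold s1, m in *; lra).
assert (Hs2 : m < s2 < c) by (unfold s2, m in *; lra).
assert (I2 : 0 * (s2 - m) <= (Z s2 + ln (c - s2) / C) - (Z m + ln (c - m) / C)).
{ assert (dG : forall x : R, m <= x <= s2 ->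
    is_derive (fun x => Z x + ln (c - x) / C) x (/ F x - / (C * (c - x)))).
  { intros x Hx.
    assert (dl : is_derive (fun x => ln (c - x) / C) x (- / (C * (c - x))))
      by (auto_derive; [lra|field; lra]).
    exact (is_derive_plus Z _ x _ _ (dZ x ltac:(lra)) dl). }
  apply (increment_ge (fun x => Z x + ln (c - x) / C)); [lra| |].
  - intros x Hx; apply (is_derive_continuous _ _ _ (dG x Hx)).
  - intros x Hx; eexists; split; [apply dG; lra|].
    assert (/ (C * (c - x)) <= / F x); [|lra].
    apply Rinv_le_contravar; [apply PF|apply Fc]; lra. }
assert (I1 : 0 * (m - s1) <= (Z m - ln (m - a) / C) - (Z s1 - ln (s1 - a) / C)).
{ assert (dG : forall x : R, s1 <= x <= m ->
    is_derive (fun x => Z x - ln (x - a) / C) x (/ F x - / (C * (x - a)))).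
  { intros x Hx.
    assert (dl : is_derive (fun x => ln (x - a) / C) x (/ (C * (x - a))))
      by (auto_derive; [lra|field; lra]).
    exact (is_derive_minus Z _ x _ _ (dZ x ltac:(lra)) dl). }
  apply (increment_ge (fun x => Z x - ln (x - a) / C)); [lra| |].
  - intros x Hx; apply (is_derive_continuous _ _ _ (dG x Hx)).
  - intros x Hx; eexists; split; [apply dG; lra|].
    assert (/ (C * (x - a)) <= / F x); [|lra].
    apply Rinv_le_contravar; [apply PF|apply Fa]; lra. }
replace (c - s2) with ((c - m) * e) in I2 by (unfold s2; ring).
replace (s1 - a) with ((c - m) * e) in I1 by (unfold s1; ring).
replace (m - a) with (c - m) in I1 by (unfold m; field).
rewrite ln_mult, Hln in I1, I2 by lra.
replace ((ln (c - m) + - (C * A)) / C) with (ln (c - m) / C - A) in I1, I2 by (field; lra).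
assert (Hz := Rle_abs z); assert (Hz' := Rle_abs (- z)); rewrite Rabs_Ropp in Hz'.
destruct (IVT_interv (fun s => Z s - z) s1 s2) as [s [Hs Es]].
- intros x Hx; apply continuous_continuity_pt.
  apply (continuous_minus Z); [|apply continuous_const].
  apply (is_derive_continuous _ _ _ (dZ x ltac:(lra))).
- lra.
- unfold A in *; lra.
- unfold A in *; lra.
- exists s; split; [lra|]; fold Z; lra.
Qed.

(** [v] is the inverse of the travel time, obtained by choice; monotonicity of [Z] gives the
    limits. *)
Lemma autonomous_solution (F : R -> R) a c C :
  a < c -> 0 < C -> (forall x : R, a < x < c -> continuous F x) ->
  (forall x, a < x < c -> 0 < F x) ->
  (forall x, a < x < c -> F x <= C * (x - a)) ->
  (forall x, a < x < c -> F x <= C * (c - x)) ->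
  exists v : R -> R, (forall z, a < v z < c) /\
    (forall z : R, is_derive v z (F (v z))) /\ is_lim v m_infty a /\ is_lim v p_infty c.
Proof.
intros Hac HC CF PF Fa Fc; set (m := (a + c) / 2).
assert (Hm : a < m < c) by (unfold m; lra).
set (Z := travel_time F m).
assert (dZ : forall s, a < s < c -> is_derive Z s (/ F s)).
{ intros s Hs; now apply (is_derive_travel_time F a c). }
set (v := fun z => proj1_sig (constructive_indefinite_description _
  (travel_time_surjective F a c C z Hac HC CF PF Fa Fc))).
assert (Hv : forall z, a < v z < c /\ Z (v z) = z).
{ intros z; exact (proj2_sig (constructive_indefinite_description _
  (travel_time_surjective F a c C z Hac HC CF PF Fa Fc))). }
assert (Zlt : forall s t, a < s < c -> a < t < c -> s < t -> Z s < Z t).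
{ intros s t Hs Ht Hst; apply increment_gt0; [exact Hst| |].
  - intros x Hx; apply (is_derive_continuous _ _ _ (dZ x ltac:(lra))).
  - intros x Hx; eexists; split; [apply dZ; lra|].
    apply Rinv_0_lt_compat, PF; lra. }
assert (Zinv : forall s z, a < s < c -> Z s < z -> s < v z).
{ intros s z Hs Hz; apply Rnot_le_lt; intros [H|H].
  - specialize (Zlt (v z) s (proj1 (Hv z)) Hs H); rewrite (proj2 (Hv z)) in Zlt; lra.
  - rewrite <- H, (proj2 (Hv z)) in Hz; lra. }
assert (Zinv' : forall s z, a < s < c -> z < Z s -> v z < s).
{ intros s z Hs Hz; apply Rnot_le_lt; intros [H|H].
  - specialize (Zlt s (v z) Hs (proj1 (Hv z)) H); rewrite (proj2 (Hv z)) in Zlt; lra.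
  - rewrite H, (proj2 (Hv z)) in Hz; lra. }
assert (vlt : forall z w, z < w -> v z < v w).
{ intros z w Hzw; apply Zinv; [apply Hv|]; now rewrite (proj2 (Hv z)). }
assert (Q : forall z w, z < w -> exists x, v z < x < v w /\ v w - v z = F x * (w - z)).
{ intros z w Hzw; destruct (Hv z) as [H1 E1], (Hv w) as [H2 E2].
  destruct (mvt Z (v z) (v w)) as [x [Hx E]].
  - now apply vlt.
  - intros x Hx; apply (is_derive_continuous _ _ _ (dZ x ltac:(lra))).
  - intros x Hx; exists (/ F x); apply dZ; lra.
  - exists x; split; [exact Hx|].
    rewrite E1, E2, (is_derive_unique _ _ _ (dZ x ltac:(lra))) in E; rewrite E.
    field; generalize (PF x ltac:(lra)); lra. }
set (M := C * (c - a)).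
assert (HM : 0 < M) by (apply Rmult_lt_0_compat; lra).
assert (FM : forall x, a < x < c -> F x <= M).
{ intros x Hx; apply Rle_trans with (1 := Fa x Hx); apply Rmult_le_compat_l; lra. }
(* The mean value theorem for [Z] turns each difference quotient of [v] into a value [F x]; the
   Lipschitz bound on [v] brings [x] close to [v z], and continuity of [F] concludes. *)
assert (Q' : forall z w, z <> w -> exists x, a < x < c /\
  Rabs (x - v z) <= M * Rabs (w - z) /\ v w - v z = F x * (w - z)).
{ assert (Qb : forall z w x, z < w -> v z < x < v w -> v w - v z = F x * (w - z) ->
    v w - v z <= M * (w - z)).
  { intros z w x Hzw Hx ->; apply Rmult_le_compat_r; [lra|apply FM].
    generalize (proj1 (Hv z)) (proj1 (Hv w)); lra. }
  intros z w Hne; destruct (Rtotal_order z w) as [H|[H|H]]; [|easy|].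
  - destruct (Q z w H) as [x [Hx E]]; exists x.
    specialize (Qb z w x H Hx E); generalize (proj1 (Hv z)) (proj1 (Hv w)); intros.
    split; [lra|]; split; [|exact E]; rewrite !Rabs_pos_eq; lra.
  - destruct (Q w z H) as [x [Hx E]]; exists x.
    specialize (Qb w z x H Hx E); generalize (proj1 (Hv z)) (proj1 (Hv w)); intros.
    split; [lra|]; split; [|lra]; rewrite !Rabs_left; lra. }
exists v; split; [|split; [|split]].
- intros z; apply Hv.
- intros z; apply is_derive_Reals; intros e He.
  destruct (proj1 (continuous_eps F (v z)) (CF _ (proj1 (Hv z))) e He) as [d [Hd HF]].
  assert (Hdm : 0 < d / M) by (now apply Rdiv_lt_0_compat).
  exists (mkposreal _ Hdm); intros k Hk0 Hk; simpl in Hk.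
  destruct (Q' z (z + k)) as [x [Hx [Hxz E]]]; [lra|].
  replace (z + k - z) with k in Hxz, E by ring; rewrite E.
  replace (F x * k / k) with (F x) by (field; exact Hk0).
  apply HF; apply Rle_lt_trans with (1 := Hxz).
  apply Rlt_div_r in Hk; lra.
- apply is_lim_spec; intros e.
  set (s := Rmin m (a + e / 2)); assert (He := cond_pos e).
  assert (Hs : a < s <= m /\ s <= a + e / 2).
  { unfold s; split; [split; [apply Rmin_glb_lt; lra|apply Rmin_l]|apply Rmin_r]. }
  exists (Z s); intros z Hz; specialize (Zinv' s z ltac:(lra) Hz).
  generalize (proj1 (Hv z)); intros; rewrite Rabs_pos_eq; lra.
- apply is_lim_spec; intros e.
  set (s := Rmax m (c - e / 2)); assert (He := cond_pos e).
  assert (Hs : m <= s < c /\ c - e / 2 <= s).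
  { unfold s; split; [split; [apply Rmax_l|apply Rmax_lub_lt; lra]|apply Rmax_r]. }
  exists (Z s); intros z Hz; specialize (Zinv s z ltac:(lra) Hz).
  generalize (proj1 (Hv z)); intros; rewrite Rabs_left; lra.
Qed.

(** The equation as a first-order system. The sign of [b] is left free because the reversal
    [z -> - z] changes it. *)
Record profile (h : R -> R) (b : R) (v p : R -> R) : Prop := {
  profile_range : forall z, 0 <= v z <= 1;
  profile_v : forall z : R, is_derive v z (p z);
  profile_p : forall z : R, is_derive p z (curv (p z) * (b * p z - h (v z)))
}.

Lemma profile_of_orbit h b q C F :
  0 <= q < 1 -> orbit h b q C F ->
  exists v p, profile h b v p /\ (forall z, 0 < p z) /\
    is_lim v m_infty q /\ is_lim v p_infty 1.
Proof.
intros Hq [PF dF Fl Fr].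
destruct (autonomous_solution F q 1 (Rmax 1 C)) as [v [Hv [dv [L1 L2]]]]; try lra.
- apply Rlt_le_trans with (2 := Rmax_l _ _); lra.
- intros x Hx; apply (is_derive_continuous _ _ _ (dF x Hx)).
- exact PF.
- intros x Hx; apply Rle_trans with (1 := Fl x Hx).
  apply Rmult_le_compat_r; [lra|apply Rmax_r].
- intros x Hx; apply Rle_trans with (1 := Fr x Hx).
  apply Rmult_le_compat_r; [lra|apply Rmax_r].
- exists v, (fun z => F (v z)); split; [|split; [|split]]; auto.
  split; [|exact dv|].
  + intros z; generalize (Hv z); lra.
  + intros z; refine (is_derive_eq _ _ _ _ (is_derive_comp F v z _ _ (dF _ (Hv z)) (dv z)) _).
    unfold scal; simpl; unfold mult; simpl.
    field; generalize (PF _ (Hv z)); lra.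
Qed.

(** * Necessary conditions *)

Lemma kin_abs p : kin (Rabs p) = kin p.
Proof. unfold Rabs; destruct (Rcase_abs p); [apply kin_opp|reflexivity]. Qed.

Lemma abs_lt_of_kin_lt p e : 0 <= e -> kin p < kin e -> Rabs p < e.
Proof.
intros He H; apply Rnot_le_lt; intros Hn.
generalize (kin_le e (Rabs p) ltac:(lra)); rewrite kin_abs; lra.
Qed.

Lemma kin_le_abs p : kin p <= Rabs p.
Proof.
rewrite <- kin_abs; generalize (Rabs_pos p); generalize (Rabs p); intros x Hx.
enough (kin x - kin 0 <= 1 * (x - 0)) by (rewrite kin_0 in *; lra).
apply increment_le; [exact Hx| |].
- intros t _; apply (is_derive_continuous _ _ _ (is_derive_kin t)).
- intros t Ht; eexists; split; [apply is_derive_kin|].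
  apply Rle_div_l; [generalize (curv_ge1 t); lra|].
  apply Rle_trans with ((1 + t ^ 2) * 1); [nra|]; rewrite Rmult_1_l.
  apply Rmult_le_compat_l; [nra|apply sqrt_1p2_ge1].
Qed.

Lemma flux_le_abs p : Rabs (flux p) <= Rabs p.
Proof.
unfold flux, Rdiv; generalize (sqrt_1p2_ge1 p); intros S1.
rewrite Rabs_mult, (Rabs_pos_eq (/ _)).
- rewrite <- (Rmult_1_r (Rabs p)) at 2; apply Rmult_le_compat_l; [apply Rabs_pos|].
  apply Rle_trans with (/ 1); [apply Rinv_le_contravar; lra|lra].
- apply Rlt_le, Rinv_0_lt_compat; lra.
Qed.

Lemma continuous_curv (p : R) : continuous curv p.
Proof.
apply (ex_derive_continuous curv); unfold curv; auto_derive; nra.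
Qed.

Lemma is_lim_p_eps (f : R -> R) (l : R) :
  is_lim f p_infty l <->
  forall e, 0 < e -> exists M, forall z, M < z -> Rabs (f z - l) < e.
Proof.
rewrite <- is_lim_spec; split.
- intros H e He; exact (H (mkposreal e He)).
- intros H e; exact (H e (cond_pos e)).
Qed.

Lemma is_lim_m_eps (f : R -> R) (l : R) :
  is_lim f m_infty l <->
  forall e, 0 < e -> exists M, forall z, z < M -> Rabs (f z - l) < e.
Proof.
rewrite <- is_lim_spec; split.
- intros H e He; exact (H (mkposreal e He)).
- intros H e; exact (H e (cond_pos e)).
Qed.

Lemma is_lim_reverse (f : R -> R) (l : R) :
  is_lim f m_infty l -> is_lim (fun z => f (- z)) p_infty l.
Proof.
rewrite is_lim_m_eps, is_lim_p_eps; intros H e He.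
destruct (H e He) as [M HM]; exists (- M); intros z Hz; apply HM; lra.
Qed.

Lemma is_lim_flip (v : R -> R) (x : Rbar) (q : R) :
  is_lim v x q -> is_lim (fun z => 1 - v z) x (1 - q).
Proof.
intros H; apply (is_lim_minus' (fun _ => 1) v x 1 q); [apply is_lim_const|exact H].
Qed.

Lemma nondecreasing_bounded_lim (f : R -> R) M :
  (forall x y, x <= y -> f x <= f y) -> (forall x, f x <= M) ->
  exists l : R, is_lim f p_infty l.
Proof.
intros Hf HM.
destruct (completeness (fun y => exists x, y = f x)) as [l [Hub Hlub]].
{ exists M; intros y [x ->]; apply HM. }
{ now exists (f 0), 0. }
exists l; apply is_lim_p_eps; intros e He.
destruct (classic (exists x, l - e < f x)) as [[x Hx]|Hn].
- exists x; intros z Hz; specialize (Hf x z ltac:(lra)).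
  assert (f z <= l) by (apply Hub; now exists z).
  apply Rabs_lt_between; lra.
- exfalso; assert (l <= l - e); [|lra].
  apply Hlub; intros y [x ->]; apply Rnot_lt_le; intros Hx; apply Hn; now exists x.
Qed.

Lemma profile_reverse h b v p :
  profile h b v p -> profile h (- b) (fun z => v (- z)) (fun z => - p (- z)).
Proof.
intros [Hr Hv Hp].
assert (Hs : forall t : R, is_derive (fun s => - s) t (-1))
  by (intros t; auto_derive; [trivial|ring]).
split.
- intros z; apply Hr.
- intros z; refine (is_derive_eq _ _ _ _ (is_derive_comp v _ z _ _ (Hv (- z)) (Hs z)) _).
  unfold scal; simpl; unfold mult; simpl; ring.
- intros z; refine (is_derive_eq _ _ _ _ (is_derive_opp _ _ _
    (is_derive_comp p _ z _ _ (Hp (- z)) (Hs z))) _).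
  rewrite curv_opp; unfold scal, opp; simpl; unfold mult; simpl; ring.
Qed.

Lemma profile_flip h b v p :
  profile h b v p ->
  profile (fun s => - h (1 - s)) b (fun z => 1 - v z) (fun z => - p z).
Proof.
intros [Hr Hv Hp]; split.
- intros z; specialize (Hr z); lra.
- intros z; assert (dc : is_derive (fun _ => 1) z 0) by apply (is_derive_const 1 z).
  refine (is_derive_eq _ _ _ _ (is_derive_minus _ v z _ _ dc (Hv z)) _).
  unfold minus, plus, opp; simpl; ring.
- intros z; refine (is_derive_eq _ _ _ _ (is_derive_opp p z _ (Hp z)) _).
  rewrite curv_opp; replace (1 - (1 - v z)) with (v z) by ring.
  unfold opp; simpl; ring.
Qed.

Lemma profile_flux h b v p (z : R) :
  profile h b v p -> is_derive (fun z => flux (p z)) z (b * p z - h (v z)).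
Proof.
intros [_ _ Hp].
refine (is_derive_eq _ _ _ _ (is_derive_comp flux p z _ _ (is_derive_flux _) (Hp z)) _).
unfold scal; simpl; unfold mult; simpl; field; generalize (curv_ge1 (p z)); lra.
Qed.

Lemma profile_kin h b v p (z : R) :
  profile h b v p -> is_derive (fun z => kin (p z)) z (p z * (b * p z - h (v z))).
Proof.
intros [_ _ Hp].
refine (is_derive_eq _ _ _ _ (is_derive_comp kin p z _ _ (is_derive_kin _) (Hp z)) _).
unfold scal; simpl; unfold mult; simpl; field; generalize (curv_ge1 (p z)); lra.
Qed.

(** * The energy along a profile and its limits *)

Definition energy (h v p : R -> R) (z : R) : R := kin (p z) + potential h (v z).

Lemma is_derive_energy h b v p (z : R) :
  (forall s, continuous h s) -> profile h b v p ->
  is_derive (energy h v p) z (b * p z ^ 2).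
Proof.
intros Ch Hpr.
assert (dG := is_derive_comp (potential h) v z _ _
  (is_derive_potential h (v z) Ch) (profile_v _ _ _ _ Hpr z)).
refine (is_derive_eq _ _ _ _ (is_derive_plus _ _ z _ _ (profile_kin _ _ _ _ z Hpr) dG) _).
unfold plus, scal; simpl; unfold mult; simpl; ring.
Qed.

Lemma energy_nondecreasing h b v p z1 z2 :
  (forall s, continuous h s) -> 0 <= b -> profile h b v p -> z1 <= z2 ->
  energy h v p z1 <= energy h v p z2.
Proof.
intros Ch Hb Hpr Hz.
enough (0 * (z2 - z1) <= energy h v p z2 - energy h v p z1) by lra.
apply increment_ge; [exact Hz| |].
- intros x _; apply (is_derive_continuous _ _ _ (is_derive_energy h b v p x Ch Hpr)).
- intros x _; eexists; split; [now apply (is_derive_energy h b v p)|].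
  apply Rmult_le_pos; [exact Hb|apply pow2_ge_0].
Qed.

Lemma energy_nonincreasing h b v p z1 z2 :
  (forall s, continuous h s) -> b <= 0 -> profile h b v p -> z1 <= z2 ->
  energy h v p z2 <= energy h v p z1.
Proof.
intros Ch Hb Hpr Hz.
generalize (energy_nondecreasing h (- b) _ _ (- z2) (- z1) Ch ltac:(lra)
  (profile_reverse _ _ _ _ Hpr) ltac:(lra)).
unfold energy; rewrite !Ropp_involutive, !kin_opp; trivial.
Qed.

Lemma potential_bound h al ga l s :
  bistable h al ga l -> 0 <= s <= 1 -> Rabs (potential h s) <= ga.
Proof.
intros B Hs; assert (Hg := bi_ga _ _ _ _ B).
apply Rle_trans with ((s - 0) * ga).
- apply abs_RInt_le_const; [lra| |].
  + apply (ex_RInt_continuous h); intros z _; apply (bi_cont _ _ _ _ B).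
  + intros t _; now apply (bistable_bound h al ga l).
- rewrite <- (Rmult_1_l ga) at 2; apply Rmult_le_compat_r; lra.
Qed.

(** The energy is monotone and bounded, so it converges, and [kin p] with it. A positive limit would
    keep [|v'|] away from zero, against the boundedness of [v]. Both signs of [b] are treated so
    that the limit at minus infinity follows by reversal. *)
Lemma profile_slope_vanishes_p h al ga l b v p (q : R) :
  bistable h al ga l -> profile h b v p -> is_lim v p_infty q -> is_lim p p_infty 0.
Proof.
intros B Hpr Lv; assert (Ch := bi_cont _ _ _ _ B).
assert (LE : exists e : R, is_lim (energy h v p) p_infty e).
{ assert (HE : forall z, - ga <= energy h v p z <= 1 + ga).
  { intros z; unfold energy; generalize (kin_range (p z)); intros.
    generalize (potential_bound h al ga l (v z) B (profile_range _ _ _ _ Hpr z)).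
    intros HG; apply Rabs_le_between in HG; lra. }
  destruct (Rle_lt_dec 0 b) as [Hb|Hb].
  - apply (nondecreasing_bounded_lim _ (1 + ga)); [|apply HE].
    intros x y Hxy; now apply (energy_nondecreasing h b).
  - destruct (nondecreasing_bounded_lim (fun z => - energy h v p z) ga) as [e He].
    + intros x y Hxy; apply Ropp_le_contravar, (energy_nonincreasing h b); auto; lra.
    + intros x; generalize (HE x); lra.
    + exists (- e).
      apply (is_lim_ext (fun z => - - energy h v p z)); [intros; ring|].
      now apply (is_lim_opp _ p_infty e). }
destruct LE as [e0 LE].
assert (Lk : is_lim (fun z => kin (p z)) p_infty (e0 - potential h q)).
{ apply (is_lim_ext (fun z => energy h v p z - potential h (v z))).
  { intros z; unfold energy; ring. }
  apply is_lim_minus'; [exact LE|].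
  apply (is_lim_comp_continuous v (potential h) p_infty q Lv).
  now apply continuous_potential. }
set (k := e0 - potential h q) in *.
assert (Hk : k = 0).
{ destruct (Rtotal_order k 0) as [H|[H|H]]; [exfalso|exact H|exfalso].
  - destruct (proj1 (is_lim_p_eps _ _) Lk (- k)) as [M HM]; [lra|].
    specialize (HM (M + 1) ltac:(lra)); apply Rabs_lt_between in HM.
    generalize (kin_range (p (M + 1))); lra.
  - destruct (proj1 (is_lim_p_eps _ _) Lk (k / 2)) as [M HM]; [lra|].
    assert (Hk2 : 0 < k / 2 < 1).
    { specialize (HM (M + 1) ltac:(lra)); apply Rabs_lt_between in HM.
      generalize (kin_range (p (M + 1))); lra. }
    set (d := slope (k / 2)); assert (Hd : 0 < d) by now apply slope_gt0.
    assert (Hp : forall z, M < z -> d <= Rabs (p z)).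
    { intros z Hz; apply Rnot_lt_le; intros Hlt.
      assert (kin (Rabs (p z)) < kin d) by (apply kin_lt; split; [apply Rabs_pos|exact Hlt]).
      rewrite kin_abs in H0; unfold d in H0; rewrite kin_slope in H0 by lra.
      specialize (HM z Hz); apply Rabs_lt_between in HM; lra. }
    (* Over a length [2 / d] the profile would vary by at least 2, while its values lie in [0,1]. *)
    assert (Hd2 : 0 < 2 / d) by (apply Rdiv_lt_0_compat; lra).
    destruct (mvt v (M + 1) (M + 1 + 2 / d)) as [x [Hx E]]; [lra| | |].
    + intros x _; apply (is_derive_continuous _ _ _ (profile_v _ _ _ _ Hpr x)).
    + intros x _; eexists; apply (profile_v _ _ _ _ Hpr x).
    + rewrite (is_derive_unique _ _ _ (profile_v _ _ _ _ Hpr x)) in E.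
      assert (A : Rabs (p x * (M + 1 + 2 / d - (M + 1))) <= 1).
      { rewrite <- E; apply Rabs_le_between.
        generalize (profile_range _ _ _ _ Hpr (M + 1)).
        generalize (profile_range _ _ _ _ Hpr (M + 1 + 2 / d)); lra. }
      replace (M + 1 + 2 / d - (M + 1)) with (2 / d) in A by ring.
      rewrite Rabs_mult, (Rabs_pos_eq (2 / d)) in A by lra.
      assert (d * (2 / d) <= Rabs (p x) * (2 / d)).
      { apply Rmult_le_compat_r; [lra|apply Hp; lra]. }
      replace (d * (2 / d)) with 2 in H0 by (field; lra); lra. }
rewrite Hk in Lk; apply is_lim_p_eps; intros e He.
assert (Hke : 0 < kin e) by (rewrite <- kin_0; apply kin_lt; lra).
destruct (proj1 (is_lim_p_eps _ _) Lk (kin e) Hke) as [M HM].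
exists M; intros z Hz; specialize (HM z Hz); rewrite Rminus_0_r in *.
rewrite Rabs_pos_eq in HM by apply kin_range.
apply abs_lt_of_kin_lt; lra.
Qed.

Lemma profile_slope_vanishes_m h al ga l b v p (q : R) :
  bistable h al ga l -> profile h b v p -> is_lim v m_infty q -> is_lim p m_infty 0.
Proof.
intros B Hpr Lv.
generalize (profile_slope_vanishes_p h al ga l _ _ _ q B (profile_reverse _ _ _ _ Hpr)
  (is_lim_reverse _ _ Lv)).
rewrite is_lim_p_eps, is_lim_m_eps; intros H e He.
destruct (H e He) as [M HM]; exists (- M); intros z Hz.
specialize (HM (- z) ltac:(lra)); rewrite Ropp_involutive in HM.
rewrite Rminus_0_r in *; now rewrite Rabs_Ropp in HM.
Qed.

Lemma energy_lim h v p (x : Rbar) (q : R) :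
  (forall s, continuous h s) -> is_lim v x q -> is_lim p x 0 ->
  is_lim (energy h v p) x (potential h q).
Proof.
intros Ch Lv Lp; replace (potential h q) with (kin 0 + potential h q)
  by (rewrite kin_0; ring).
apply is_lim_plus'.
- apply (is_lim_comp_continuous p kin x 0 Lp).
  apply (is_derive_continuous _ _ _ (is_derive_kin 0)).
- apply (is_lim_comp_continuous v (potential h) x q Lv).
  now apply continuous_potential.
Qed.

Lemma energy_ge_start h al ga l b v p (q : R) z :
  bistable h al ga l -> 0 <= b -> profile h b v p -> is_lim v m_infty q ->
  potential h q <= energy h v p z.
Proof.
intros B Hb Hpr Lv; assert (Ch := bi_cont _ _ _ _ B).
assert (L := energy_lim h v p m_infty q Ch Lv
  (profile_slope_vanishes_m h al ga l b v p q B Hpr Lv)).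
refine (is_lim_le_loc (energy h v p) (fun _ => energy h v p z) m_infty
  (potential h q) (energy h v p z) _ L (is_lim_const _ _)).
exists z; intros x Hx; apply (energy_nondecreasing h b); auto; lra.
Qed.

(** For [b >= 0] a front climbs the potential, which excludes the directions 1 to [al], 0 to [al]
    and 1 to 0. *)
Lemma potential_le_along_front h al ga l b v p (q1 q2 : R) :
  bistable h al ga l -> 0 <= b -> profile h b v p ->
  is_lim v m_infty q1 -> is_lim v p_infty q2 -> potential h q1 <= potential h q2.
Proof.
intros B Hb Hpr L1 L2; assert (Ch := bi_cont _ _ _ _ B).
assert (L := energy_lim h v p p_infty q2 Ch L2
  (profile_slope_vanishes_p h al ga l b v p q2 B Hpr L2)).
refine (is_lim_le_loc (fun _ => potential h q1) (energy h v p) p_infty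
  (potential h q1) (potential h q2) _ (is_lim_const _ _) L).
exists 0; intros x _; now apply (energy_ge_start h al ga l b).
Qed.

(** * Equilibria are not reached in finite time *)

(** Gronwall's argument for the squared distance [N] to [(e, 0)]. Only the constant solution is
    compared, so a linear bound on [h] at [e] replaces a Lipschitz condition. *)
Lemma profile_equilibrium_forward h b v p e L z0 z :
  0 <= L -> (forall s, 0 <= s <= 1 -> Rabs (h s) <= L * Rabs (s - e)) ->
  profile h b v p -> v z0 = e -> p z0 = 0 -> z0 <= z -> v z = e.
Proof.
intros HL Hh Hpr Hv0 Hp0 Hz.
assert (dv := profile_v _ _ _ _ Hpr); assert (dp := profile_p _ _ _ _ Hpr).
destruct (continuity_ab_maj (fun z => curv (p z)) z0 z Hz) as [zm [Hmax _]].
{ intros x _; apply continuous_continuity_pt.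
  apply (continuous_comp p curv); [|apply continuous_curv].
  apply (is_derive_continuous _ _ _ (dp x)). }
set (K := curv (p zm)) in *.
(* The three summands bound the contributions of [2 u q], of the term in [b] and of the term in [h]
   to [N'], each relative to [N]. *)
set (A := 1 + 2 * K * Rabs b + K * L).
set (N := fun z => (v z - e) ^ 2 + p z ^ 2).
assert (dN : forall x : R, is_derive (fun z => N z * exp (- A * (z - z0))) x
  ((2 * (v x - e) * p x + 2 * p x * (curv (p x) * (b * p x - h (v x))) - A * N x)
   * exp (- A * (x - z0)))).
{ intros x.
  assert (d2 : is_derive N x
    (2 * (v x - e) * p x + 2 * p x * (curv (p x) * (b * p x - h (v x))))).
  { assert (da : is_derive (fun z => (v z - e) ^ 2) x (2 * (v x - e) * p x)).
    { assert (ds : is_derive (fun s => (s - e) ^ 2) (v x) (2 * (v x - e)))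
        by (auto_derive; [trivial|ring]).
      refine (is_derive_eq _ _ _ _ (is_derive_comp _ v x _ _ ds (dv x)) _).
      unfold scal; simpl; unfold mult; simpl; ring. }
    assert (db : is_derive (fun z => p z ^ 2) x
      (2 * p x * (curv (p x) * (b * p x - h (v x))))).
    { assert (ds : is_derive (fun s => s ^ 2) (p x) (2 * p x))
        by (auto_derive; [trivial|ring]).
      refine (is_derive_eq _ _ _ _ (is_derive_comp _ p x _ _ ds (dp x)) _).
      unfold scal; simpl; unfold mult; simpl; ring. }
    exact (is_derive_plus _ _ x _ _ da db). }
  assert (de : is_derive (fun z => exp (- A * (z - z0))) x (- A * exp (- A * (x - z0))))
    by (auto_derive; [trivial|unfold Rminus; ring]).
  refine (is_derive_eq _ _ _ _ (is_derive_mult N _ x _ _ d2 de Rmult_comm) _).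
  unfold plus, mult; simpl; ring. }
assert (I : N z * exp (- A * (z - z0)) - N z0 * exp (- A * (z0 - z0)) <= 0 * (z - z0)).
{ apply (increment_le (fun z => N z * exp (- A * (z - z0)))); [exact Hz| |].
  - intros x _; apply (is_derive_continuous _ _ _ (dN x)).
  - intros x Hx; eexists; split; [apply dN|].
    rewrite <- (Rmult_0_l (exp (- A * (x - z0)))).
    apply Rmult_le_compat_r; [apply Rlt_le, exp_pos|].
    assert (Hc : 0 <= curv (p x) <= K).
    { split; [generalize (curv_ge1 (p x)); lra|apply Hmax; lra]. }
    assert (Hhx := Hh (v x) (profile_range _ _ _ _ Hpr x)).
    set (c := curv (p x)) in *; set (q := p x) in *; set (u := v x - e) in *.
    assert (NE : N x = u ^ 2 + q ^ 2) by reflexivity; rewrite NE.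
    assert (E1 : 2 * u * q <= u ^ 2 + q ^ 2) by (generalize (pow2_ge_0 (u - q)); lra).
    assert (E2 : 2 * q * (c * (b * q)) <= 2 * K * Rabs b * (u ^ 2 + q ^ 2)).
    { assert (c * b <= K * Rabs b).
      { apply Rle_trans with (c * Rabs b).
        - apply Rmult_le_compat_l; [lra|apply Rle_abs].
        - apply Rmult_le_compat_r; [apply Rabs_pos|lra]. }
      assert (0 <= K * Rabs b) by (apply Rmult_le_pos; [lra|apply Rabs_pos]).
      assert (0 <= q ^ 2) by apply pow2_ge_0; assert (0 <= u ^ 2) by apply pow2_ge_0.
      apply Rle_trans with (2 * (K * Rabs b) * q ^ 2).
      - replace (2 * q * (c * (b * q))) with (2 * (c * b) * q ^ 2) by ring.
        apply Rmult_le_compat_r; lra.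
      - replace (2 * K * Rabs b * (u ^ 2 + q ^ 2))
          with (2 * (K * Rabs b) * (u ^ 2 + q ^ 2)) by ring.
        apply Rmult_le_compat_l; lra. }
    assert (E3 : - (2 * q * (c * h (v x))) <= K * L * (u ^ 2 + q ^ 2)).
    { apply Rle_trans with (2 * Rabs q * (K * (L * Rabs u))).
      - apply Rle_trans with (Rabs (2 * q * (c * h (v x)))).
        + rewrite <- Rabs_Ropp; apply Rle_abs.
        + rewrite !Rabs_mult, (Rabs_pos_eq 2), (Rabs_pos_eq c) by lra.
          apply Rmult_le_compat_l.
          * apply Rmult_le_pos; [lra|apply Rabs_pos].
          * apply Rmult_le_compat; [lra|apply Rabs_pos|lra|exact Hhx].
      - replace (2 * Rabs q * (K * (L * Rabs u))) with (K * L * (2 * Rabs q * Rabs u)) by ring.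
        apply Rmult_le_compat_l; [apply Rmult_le_pos; lra|].
        rewrite <- (pow2_abs u), <- (pow2_abs q).
        generalize (pow2_ge_0 (Rabs u - Rabs q)); lra. }
    unfold A; lra. }
assert (N0 : N z0 = 0) by (unfold N; rewrite Hv0, Hp0; ring).
rewrite N0 in I.
assert (He := exp_pos (- A * (z - z0))).
assert (HN : N z <= 0).
{ apply Rnot_lt_le; intros Hlt; assert (0 < N z * exp (- A * (z - z0)))
    by (now apply Rmult_lt_0_compat); lra. }
unfold N in HN; assert (0 <= p z ^ 2) by apply pow2_ge_0.
assert (v z - e = 0) by nra; lra.
Qed.

Lemma bistable_linear_bound_0 h al ga l :
  bistable h al ga l ->
  exists L, 0 <= L /\ forall s, 0 <= s <= 1 -> Rabs (h s) <= L * Rabs (s - 0).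
Proof.
intros B; assert (Hal := bi_al _ _ _ _ B); assert (Hl := bi_l _ _ _ _ B).
exists (Rmax l (ga / al)); split; [apply Rle_trans with (2 := Rmax_l _ _); lra|].
intros s Hs; rewrite Rminus_0_r, (Rabs_pos_eq s) by lra.
destruct (Rle_lt_dec s al) as [H|H].
- apply Rle_trans with (l * s); [|apply Rmult_le_compat_r; [lra|apply Rmax_l]].
  assert (Hlow := bi_low _ _ _ _ B s Hs).
  assert (Hneg : h s <= 0).
  { destruct (Rle_lt_or_eq_dec 0 s) as [H0|<-]; [lra| |].
    - destruct (Rle_lt_or_eq_dec s al H) as [H1| ->].
      + generalize (bi_neg _ _ _ _ B s ltac:(lra)); lra.
      + rewrite (bi_zero _ _ _ _ B); lra.
    - rewrite (bi_out _ _ _ _ B); lra. }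
  rewrite Rabs_left1; lra.
- apply Rle_trans with (ga / al * s); [|apply Rmult_le_compat_r; [lra|apply Rmax_r]].
  apply Rle_trans with (1 := bistable_bound h al ga l s B).
  replace (ga / al * s) with (ga * s / al) by (field; lra).
  apply Rle_div_r; [lra|]; apply Rmult_le_compat_l; [|lra].
  generalize (bi_ga _ _ _ _ B); lra.
Qed.

Lemma bistable_linear_bound h al ga l e :
  bistable h al ga l -> e = 0 \/ e = al \/ e = 1 ->
  exists L, 0 <= L /\ forall s, 0 <= s <= 1 -> Rabs (h s) <= L * Rabs (s - e).
Proof.
intros B [->|[->| ->]].
- now apply (bistable_linear_bound_0 h al ga l).
- exists ga; split; [generalize (bi_ga _ _ _ _ B); lra|apply (bi_tangent _ _ _ _ B)].
- destruct (bistable_linear_bound_0 _ _ _ _ (bistable_flip _ _ _ _ B)) as [L [HL H]].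
  exists L; split; [exact HL|]; intros s Hs.
  specialize (H (1 - s) ltac:(lra)); rewrite Rabs_Ropp in H.
  replace (1 - (1 - s)) with s in H by ring.
  replace (s - 1) with (- (1 - s - 0)) by ring; now rewrite Rabs_Ropp.
Qed.

Lemma profile_equilibrium h al ga l b v p e z0 :
  bistable h al ga l -> e = 0 \/ e = al \/ e = 1 ->
  profile h b v p -> v z0 = e -> p z0 = 0 -> forall z, v z = e.
Proof.
intros B He Hpr Hv0 Hp0 z.
destruct (bistable_linear_bound h al ga l e B He) as [L [HL Hh]].
destruct (Rle_lt_dec z0 z) as [Hz|Hz].
- now apply (profile_equilibrium_forward h b v p e L z0 z).
- rewrite <- (Ropp_involutive z).
  apply (profile_equilibrium_forward h (- b) (fun z => v (- z)) (fun z => - p (- z))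
    e L (- z0) (- z)); try lra; auto.
  + now apply profile_reverse.
  + now rewrite Ropp_involutive.
  + rewrite Ropp_involutive; lra.
Qed.

(** * Increasing fronts and the speed threshold at [al] *)

Lemma increasing_slope_nonneg (v : R -> R) (z k : R) :
  increasing v -> is_derive v z k -> 0 <= k.
Proof.
intros Hv Hd; apply Rnot_lt_le; intros Hk.
destruct (proj1 (is_derive_neg_near v z k Hd Hk 1 Rlt_0_1)) as [t [Ht Hvt]].
specialize (Hv z t ltac:(lra)); lra.
Qed.

Lemma increasing_ge_lim (v : R -> R) (q : R) z :
  increasing v -> is_lim v m_infty q -> q <= v z.
Proof.
intros Hv L.
refine (is_lim_le_loc v (fun _ => v z) m_infty q (v z) _ L (is_lim_const _ _)).
exists z; intros x Hx; apply Hv; lra.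
Qed.

Lemma increasing_le_lim (v : R -> R) (q : R) z :
  increasing v -> is_lim v p_infty q -> v z <= q.
Proof.
intros Hv L.
refine (is_lim_le_loc (fun _ => v z) v p_infty (v z) q _ (is_lim_const _ _) L).
exists z; intros x Hx; apply Hv; lra.
Qed.

Lemma constant_lim (v : R -> R) (x : Rbar) (e q : R) :
  (forall z, v z = e) -> is_lim v x q -> e = q.
Proof.
intros Hv L.
assert (L' : is_lim v x e).
{ apply (is_lim_ext (fun _ => e)); [intros; now rewrite Hv|apply is_lim_const]. }
generalize (is_lim_unique _ _ _ L) (is_lim_unique _ _ _ L').
intros E1 E2; rewrite E1 in E2; now injection E2.
Qed.

(** A point where [v = q1] is a minimum, hence has zero slope, and [v] would then be the constant
    [q1]. *)
Lemma increasing_front_above h al ga l b v p (q1 q2 : R) z :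
  bistable h al ga l -> q1 = 0 \/ q1 = al \/ q1 = 1 -> q1 <> q2 ->
  profile h b v p -> increasing v -> is_lim v m_infty q1 -> is_lim v p_infty q2 ->
  q1 < v z.
Proof.
intros B Hq Hne Hpr Hv L1 L2.
destruct (increasing_ge_lim v q1 z Hv L1) as [H|H]; [exact H|exfalso].
apply Hne, (constant_lim v p_infty q1 q2); [|exact L2].
apply (profile_equilibrium h al ga l b v p q1 z); auto.
apply (is_derive_at_min v z (p z) 1 Rlt_0_1 (profile_v _ _ _ _ Hpr z)).
intros t _; rewrite <- H; now apply increasing_ge_lim.
Qed.

Lemma increasing_front_below h al ga l b v p (q1 q2 : R) z :
  bistable h al ga l -> q2 = 0 \/ q2 = al \/ q2 = 1 -> q1 <> q2 ->
  profile h b v p -> increasing v -> is_lim v m_infty q1 -> is_lim v p_infty q2 ->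
  v z < q2.
Proof.
intros B Hq Hne Hpr Hv L1 L2.
destruct (increasing_le_lim v q2 z Hv L2) as [H|H]; [exact H|exfalso].
apply Hne; symmetry; apply (constant_lim v m_infty q2 q1); [|exact L1].
apply (profile_equilibrium h al ga l b v p q2 z); auto.
enough (- p z = 0) by lra.
apply (is_derive_at_min (fun z => - v z) z (- p z) 1 Rlt_0_1).
- apply (is_derive_opp v z _ (profile_v _ _ _ _ Hpr z)).
- intros t _; rewrite H; apply Ropp_le_contravar; now apply increasing_le_lim.
Qed.

(* If [b ^ 2 < 4 ga], the ratio [rho = v' / (v - al)] satisfies a Riccati
   inequality [rho' <= - ((rho - B / 2) ^ 2 + e0 ^ 2)] near minus infinity, so
   that [atan] of its normalization would be unbounded. *)
Lemma monostable_front_speed h al ga l b v p :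
  bistable h al ga l -> 0 <= b -> profile h b v p -> increasing v ->
  is_lim v m_infty al -> is_lim v p_infty 1 -> 4 * ga <= b ^ 2.
Proof.
intros B Hb Hpr Hv L1 L2; apply Rnot_lt_le; intros Hlt.
assert (Hal := bi_al _ _ _ _ B); assert (Hg := bi_ga _ _ _ _ B).
assert (dv := profile_v _ _ _ _ Hpr); assert (dp := profile_p _ _ _ _ Hpr).
assert (Hp : forall z, 0 <= p z).
{ intros z; apply (increasing_slope_nonneg v z); [exact Hv|apply dv]. }
assert (Hu : forall z, 0 < v z - al).
{ intros z; assert (al < v z); [|lra].
  apply (increasing_front_above h al ga l b v p al 1); auto; lra. }
assert (Lp := profile_slope_vanishes_m h al ga l b v p al B Hpr L1).
(* The gap [d / 4 = ga - b ^ 2 / 4] is split in three: [d / 12] for replacing [curv p * b] by [Bb],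
   [d / 12] for replacing [h] by its linear part, and the remaining [d / 12 = e0 ^ 2]. *)
set (d := 4 * ga - b ^ 2); assert (Hd : 0 < d) by (unfold d; lra).
set (Bb := sqrt (b ^ 2 + d / 3)).
assert (HB : 0 <= Bb /\ Bb ^ 2 = b ^ 2 + d / 3).
{ split; [apply sqrt_pos|]; apply pow2_sqrt.
  assert (0 <= b ^ 2) by apply pow2_ge_0; lra. }
assert (HbB : b < Bb).
{ apply Rnot_le_lt; intros H; assert (Bb ^ 2 <= b ^ 2) by (apply pow_incr; lra); lra. }
assert (N1 : exists M, forall z, z < M -> curv (p z) * b <= Bb).
{ assert (Lc : is_lim (fun z => curv (p z) * b) m_infty (curv 0 * b)).
  { apply (is_lim_comp_continuous p (fun x => curv x * b) m_infty 0 Lp).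
    apply (continuous_mult curv (fun _ => b)); [apply continuous_curv|apply continuous_const]. }
  replace (curv 0 * b) with b in Lc.
  2: { unfold curv; replace (1 + 0 ^ 2) with 1 by ring; rewrite sqrt_1; ring. }
  destruct (proj1 (is_lim_m_eps _ _) Lc (Bb - b)) as [M HM]; [lra|].
  exists M; intros z Hz; specialize (HM z Hz); apply Rabs_lt_between in HM; lra. }
assert (N2 : exists M, forall z, z < M -> (ga - d / 12) * (v z - al) <= h (v z)).
{ destruct (is_derive_eps h al ga (bi_derive _ _ _ _ B) (d / 12)) as [r [Hr Hh]]; [lra|].
  destruct (proj1 (is_lim_m_eps _ _) L1 r Hr) as [M HM].
  exists M; intros z Hz; specialize (Hh (v z) (HM z Hz)).
  rewrite (bi_zero _ _ _ _ B), (Rabs_pos_eq (v z - al)) in Hh by (generalize (Hu z); lra).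
  apply Rabs_le_between in Hh; lra. }
destruct N1 as [M1 N1], N2 as [M2 N2].
set (M := Rmin M1 M2).
set (e0 := sqrt (d / 12)).
assert (He0 : 0 < e0) by (apply sqrt_lt_R0; lra).
assert (He2 : e0 ^ 2 = d / 12) by (apply pow2_sqrt; lra).
set (sg := fun z => (p z / (v z - al) - Bb / 2) / e0).
assert (dsg : forall z : R, z < M -> exists k, is_derive sg z k /\
  k <= - e0 * (1 + sg z ^ 2)).
{ intros z Hz.
  assert (Hz1 : z < M1) by (apply Rlt_le_trans with (1 := Hz), Rmin_l).
  assert (Hz2 : z < M2) by (apply Rlt_le_trans with (1 := Hz), Rmin_r).
  specialize (N1 z Hz1); specialize (N2 z Hz2); specialize (Hu z); specialize (Hp z).
  set (u := v z - al) in *; set (c := curv (p z)) in *.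
  set (rho := p z / u).
  assert (Hrho : 0 <= rho) by (now apply Rdiv_le_0_compat).
  exists ((c * (b * p z - h (v z)) / u - rho ^ 2) / e0); split.
  - assert (du : is_derive (fun z => v z - al) z (p z)).
    { assert (dc : is_derive (fun _ => al) z 0) by apply (is_derive_const al z).
      refine (is_derive_eq _ _ _ _ (is_derive_minus v _ z _ _ (dv z) dc) _).
      unfold minus, plus, opp; simpl; ring. }
    assert (dr : is_derive (fun z => p z / (v z - al)) z
      (c * (b * p z - h (v z)) / u - rho ^ 2)).
    { refine (is_derive_eq _ _ _ _ (is_derive_div p _ z _ _ (dp z) du _) _).
      - fold u; lra.
      - fold u c; unfold rho; field; lra. }
    assert (ds : is_derive (fun x => (x - Bb / 2) / e0) rho (/ e0))
      by (auto_derive; [trivial|field; lra]).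
    refine (is_derive_eq _ _ _ _ (is_derive_comp (fun x => (x - Bb / 2) / e0)
      (fun z => p z / (v z - al)) z _ _ ds dr) _).
    unfold scal; simpl; unfold mult; simpl; unfold Rdiv; ring.
  - replace (sg z) with ((rho - Bb / 2) / e0) by reflexivity.
    replace (- e0 * (1 + ((rho - Bb / 2) / e0) ^ 2))
      with (- (e0 ^ 2 + (rho - Bb / 2) ^ 2) / e0) by (field; lra).
    apply Rmult_le_compat_r; [apply Rlt_le, Rinv_0_lt_compat, He0|].
    assert (Hc1 : 1 <= c) by apply curv_ge1.
    assert (Hpos : 0 <= ga - d / 12).
    { unfold d; assert (0 <= b ^ 2) by apply pow2_ge_0; lra. }
    assert (F1 : ga - d / 12 <= c * h (v z) / u).
    { apply Rle_div_r; [exact Hu|].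
      assert (0 <= (ga - d / 12) * u) by (apply Rmult_le_pos; lra).
      apply Rle_trans with (1 := N2); rewrite <- (Rmult_1_l (h (v z))) at 1.
      apply Rmult_le_compat_r; lra. }
    assert (F2 : c * b * rho <= Bb * rho) by (now apply Rmult_le_compat_r).
    replace (c * (b * p z - h (v z)) / u) with (c * b * rho - c * h (v z) / u)
      by (unfold rho; field; lra).
    replace ((rho - Bb / 2) ^ 2) with (rho ^ 2 - Bb * rho + Bb ^ 2 / 4) by field.
    rewrite He2, (proj2 HB); unfold d in *; lra. }
(* Over a length [T] the function [atan (sg z)] drops by at least [PI + 1], more than the width of
   its range. *)
set (T := (PI + 1) / e0); assert (HPI := PI_RGT_0).
assert (HT : 0 < T) by (apply Rdiv_lt_0_compat; lra).
set (z1 := M - 1); set (z0 := z1 - T).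
assert (I : atan (sg z1) - atan (sg z0) <= - e0 * (z1 - z0)).
{ assert (da : forall z : R, z < M -> exists k,
    is_derive (fun z => atan (sg z)) z k /\ k <= - e0).
  { intros z Hz; destruct (dsg z Hz) as [k [Hk Hk']].
    exists (k / (1 + sg z ^ 2)).
    assert (Hpos : 0 < 1 + sg z ^ 2) by (assert (0 <= sg z ^ 2) by apply pow2_ge_0; lra).
    split; [|now apply Rle_div_l].
    assert (ds : is_derive atan (sg z) (/ (1 + sg z ^ 2))).
    { apply is_derive_Reals; apply is_derive_Reals; auto_derive; [trivial|].
      field; simpl in *; lra. }
    refine (is_derive_eq _ _ _ _ (is_derive_comp atan sg z _ _ ds Hk) _).
    unfold scal; simpl; unfold mult; simpl; unfold Rdiv; ring. }
  apply (increment_le (fun z => atan (sg z))).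
  - unfold z0; lra.
  - intros x Hx; destruct (da x) as [k [Hk _]]; [unfold z1 in *; lra|].
    apply (is_derive_continuous _ _ _ Hk).
  - intros x Hx; apply da; unfold z1 in *; lra. }
replace (- e0 * (z1 - z0)) with (- (PI + 1)) in I by (unfold z0, T; field; lra).
generalize (atan_bound (sg z1)) (atan_bound (sg z0)); lra.
Qed.

(** * Uniqueness of the speed from 0 to 1 *)

Lemma front_crosses (v : R -> R) (q1 q2 m : R) :
  (forall z, continuous v z) -> is_lim v m_infty q1 -> is_lim v p_infty q2 ->
  q1 < m < q2 -> exists z, v z = m.
Proof.
intros Cv L1 L2 Hm.
destruct (proj1 (is_lim_m_eps _ _) L1 (m - q1)) as [M1 H1]; [lra|].
destruct (proj1 (is_lim_p_eps _ _) L2 (q2 - m)) as [M2 H2]; [lra|].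
specialize (H1 (M1 - 1) ltac:(lra)); specialize (H2 (M2 + 1) ltac:(lra)).
apply Rabs_lt_between in H1; apply Rabs_lt_between in H2.
destruct (IVT_gen v (M1 - 1) (M2 + 1) m) as [z [_ Hz]].
- intros z; apply continuous_continuity_pt, Cv.
- rewrite Rmin_left, Rmax_right; lra.
- now exists z.
Qed.

(* Both profiles are compared as functions of [s = v]: through [flux] where
   [h <= 0], since [d flux / ds = b - h / p], and through [kin] where [h >= 0],
   since [d kin / ds = b p - h]. The sign [sg] covers both orders of the speeds. *)
Lemma front_speed_not_ordered h al ga l b0 C F b v p sg :
  bistable h al ga l -> orbit h b0 0 C F -> 0 <= b -> profile h b v p ->
  increasing v -> is_lim v m_infty 0 -> is_lim v p_infty 1 ->
  sg = 1 \/ sg = -1 -> ~ sg * (b - b0) < 0.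
Proof.
intros B [PF dF Fl Fr] Hb Hpr Hv L0 L1 Hsg Hord.
assert (Hal := bi_al _ _ _ _ B).
assert (dv := profile_v _ _ _ _ Hpr).
assert (Hp : forall z, 0 <= p z).
{ intros z; apply (increasing_slope_nonneg v z); [exact Hv|apply dv]. }
assert (Hv01 : forall z, 0 < v z < 1).
{ intros z; split.
  - apply (increasing_front_above h al ga l b v p 0 1); auto; lra.
  - apply (increasing_front_below h al ga l b v p 0 1); auto; lra. }
assert (Lp := profile_slope_vanishes_m h al ga l b v p 0 B Hpr L0).
assert (Lp' := profile_slope_vanishes_p h al ga l b v p 1 B Hpr L1).
destruct (front_crosses v 0 1 al) as [za Hza]; auto.
{ intros z; apply (is_derive_continuous _ _ _ (dv z)). }
assert (Hpa : 0 < p za).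
{ destruct (Hp za) as [H|H]; [exact H|exfalso].
  assert (E := profile_equilibrium h al ga l b v p al za B ltac:(auto) Hpr Hza (eq_sym H)).
  generalize (constant_lim v p_infty al 1 E L1); lra. }
assert (C1 : Rmax 0 C >= 0) by (apply Rle_ge, Rmax_l).
assert (Fl' : forall z, F (v z) <= Rmax 0 C * v z).
{ intros z; generalize (Fl (v z) (Hv01 z)); rewrite Rminus_0_r; intros H.
  apply Rle_trans with (1 := H), Rmult_le_compat_r; [generalize (Hv01 z); lra|apply Rmax_r]. }
assert (Fr' : forall z, F (v z) <= Rmax 0 C * (1 - v z)).
{ intros z; apply Rle_trans with (1 := Fr (v z) (Hv01 z)).
  apply Rmult_le_compat_r; [generalize (Hv01 z); lra|apply Rmax_r]. }
assert (dFv : forall z : R, is_derive (fun z => F (v z)) z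
  (curv (F (v z)) * (b0 - h (v z) / F (v z)) * p z)).
{ intros z; refine (is_derive_eq _ _ _ _ (is_derive_comp F v z _ _ (dF _ (Hv01 z)) (dv z)) _).
  unfold scal; simpl; unfold mult; simpl; ring. }
set (DL := fun z => sg * (flux (p z) - flux (F (v z)))).
set (DR := fun z => sg * (kin (p z) - kin (F (v z)))).
assert (dDL : forall z : R, is_derive DL z
  (sg * (b * p z - h (v z) - (b0 - h (v z) / F (v z)) * p z))).
{ intros z.
  assert (d1 := is_derive_comp flux _ z _ _ (is_derive_flux _) (dFv z)).
  refine (is_derive_eq _ _ _ _ (is_derive_scal _ z sg _
    (is_derive_minus _ _ z _ _ (profile_flux _ _ _ _ z Hpr) d1)) _).
  unfold scal, minus, plus, opp; simpl; unfold mult; simpl.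
  generalize (PF _ (Hv01 z)) (curv_ge1 (F (v z))); intros; field; split; lra. }
assert (dDR : forall z : R, is_derive DR z (sg * (p z * (b * p z - b0 * F (v z))))).
{ intros z.
  assert (d1 := is_derive_comp kin _ z _ _ (is_derive_kin _) (dFv z)).
  refine (is_derive_eq _ _ _ _ (is_derive_scal _ z sg _
    (is_derive_minus _ _ z _ _ (profile_kin _ _ _ _ z Hpr) d1)) _).
  unfold scal, minus, plus, opp; simpl; unfold mult; simpl.
  generalize (PF _ (Hv01 z)) (curv_ge1 (F (v z))); intros; field; split; lra. }
assert (LF : forall d, 0 < d -> exists M, forall z, z < M -> p z + F (v z) < d).
{ intros d Hd.
  destruct (proj1 (is_lim_m_eps _ _) Lp (d / 2)) as [M1 H1]; [lra|].
  destruct (proj1 (is_lim_m_eps _ _) L0 (d / 2 / (Rmax 0 C + 1))) as [M2 H2].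
  { apply Rdiv_lt_0_compat; lra. }
  exists (Rmin M1 M2); intros z Hz.
  specialize (H1 z (Rlt_le_trans _ _ _ Hz (Rmin_l _ _))).
  specialize (H2 z (Rlt_le_trans _ _ _ Hz (Rmin_r _ _))).
  apply Rabs_lt_between in H1; rewrite Rminus_0_r, Rabs_pos_eq in H2
    by (generalize (Hv01 z); lra).
  apply Rlt_div_r in H2; [|lra].
  generalize (Fl' z) (Hv01 z); intros; lra. }
assert (LF' : forall d, 0 < d -> exists M, forall z, M < z -> p z + F (v z) < d).
{ intros d Hd.
  destruct (proj1 (is_lim_p_eps _ _) Lp' (d / 2)) as [M1 H1]; [lra|].
  destruct (proj1 (is_lim_p_eps _ _) L1 (d / 2 / (Rmax 0 C + 1))) as [M2 H2].
  { apply Rdiv_lt_0_compat; lra. }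
  exists (Rmax M1 M2); intros z Hz.
  specialize (H1 z (Rle_lt_trans _ _ _ (Rmax_l _ _) Hz)).
  specialize (H2 z (Rle_lt_trans _ _ _ (Rmax_r _ _) Hz)).
  apply Rabs_lt_between in H1; rewrite Rabs_left in H2 by (generalize (Hv01 z); lra).
  apply Rlt_div_r in H2; [|lra].
  generalize (Fr' z) (Hv01 z); intros; lra. }
(* A positive value of [DL] would not decrease towards minus infinity, although [DL <= p + F], which
   tends to 0 there. *)
assert (HL : forall z, z <= za -> DL z <= 0).
{ intros z1 Hz1; apply Rnot_lt_le; intros Hpos.
  destruct (LF (DL z1) Hpos) as [M HM].
  set (T := Rmax 0 (z1 - M + 1)).
  assert (HT : 0 <= T /\ z1 - M + 1 <= T) by (split; [apply Rmax_l|apply Rmax_r]).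
  assert (I : - DL (z1 - T) <= - DL (z1 - 0) + 0 * (T - 0)).
  { assert (dr : forall t : R, is_derive (fun t => - DL (z1 - t)) t
      (sg * (b * p (z1 - t) - h (v (z1 - t))
        - (b0 - h (v (z1 - t)) / F (v (z1 - t))) * p (z1 - t)))).
    { intros t; assert (Hs : is_derive (fun s => z1 - s) t (-1))
        by (auto_derive; [trivial|ring]).
      refine (is_derive_eq _ _ _ _ (is_derive_opp _ _ _
        (is_derive_comp DL _ t _ _ (dDL (z1 - t)) Hs)) _).
      unfold scal, opp; simpl; unfold mult; simpl; ring. }
    apply (barrier (fun t => - DL (z1 - t)) 0 T); try lra.
    - intros t _; apply (is_derive_continuous _ _ _ (dr t)).
    - rewrite Rminus_0_r; lra.
    - rewrite Rminus_0_r; lra.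
    - intros t Ht Hneg; eexists; split; [apply dr|].
      set (z := z1 - t) in *.
      assert (Hz : h (v z) <= 0).
      { assert (v z <= al) by (rewrite <- Hza; apply Hv; unfold z; lra).
        destruct (Rle_lt_or_eq_dec _ _ H) as [H'|H'].
        - generalize (Hv01 z) (bi_neg _ _ _ _ B (v z)); lra.
        - rewrite H', (bi_zero _ _ _ _ B); lra. }
      assert (Hcmp : 0 <= sg * (p z - F (v z))).
      { destruct (Rle_lt_dec 0 (sg * (p z - F (v z)))) as [H|H]; [exact H|exfalso].
        unfold DL in Hneg; destruct Hsg as [->| ->].
        - generalize (flux_le (p z) (F (v z)) ltac:(lra)); lra.
        - generalize (flux_le (F (v z)) (p z) ltac:(lra)); lra. }
      generalize (PF _ (Hv01 z)); intros HF.
      replace (sg * (b * p z - h (v z) - (b0 - h (v z) / F (v z)) * p z))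
        with (sg * (b - b0) * p z - (- h (v z)) * (sg * (p z - F (v z))) * / F (v z))
        by (field; lra).
      assert (0 <= - (sg * (b - b0)) * p z) by (apply Rmult_le_pos; [lra|apply Hp]).
      assert (0 <= - h (v z) * (sg * (p z - F (v z))) * / F (v z)).
      { apply Rmult_le_pos; [apply Rmult_le_pos; lra|].
        now apply Rlt_le, Rinv_0_lt_compat. }
      lra. }
  rewrite Rminus_0_r in I; specialize (HM (z1 - T) ltac:(lra)).
  assert (HF := PF _ (Hv01 (z1 - T))); assert (Hpz := Hp (z1 - T)).
  assert (A1 := flux_le_abs (p (z1 - T))); assert (A2 := flux_le_abs (F (v (z1 - T)))).
  rewrite (Rabs_pos_eq (p _)) in A1 by lra; rewrite (Rabs_pos_eq (F _)) in A2 by lra.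
  apply Rabs_le_between in A1; apply Rabs_le_between in A2.
  assert (DL (z1 - T) <= p (z1 - T) + F (v (z1 - T)));
    [unfold DL; destruct Hsg as [->| ->]; lra|lra]. }
assert (HFa := PF _ (Hv01 za)).
(* Strictness: since [h al = 0], [DL] has derivative [sg * (b - b0) * p za < 0] at [za], so
   [DL za = 0] would make [DL] positive just before. [flux] and [kin] order nonnegative slopes
   alike, which carries the sign over to [DR]. *)
assert (HRa : DR za < 0).
{ assert (Hneg : DL za < 0).
  { destruct (HL za (Rle_refl _)) as [H|H]; [exact H|exfalso].
    assert (D := dDL za); rewrite Hza, (bi_zero _ _ _ _ B) in D.
    destruct (proj2 (is_derive_neg_near _ _ _ D ltac:(
      replace (sg * (b * p za - 0 - (b0 - 0 / F al) * p za))
        with (- (- (sg * (b - b0)) * p za)) by (unfold Rdiv; ring);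
      assert (0 < - (sg * (b - b0)) * p za) by (apply Rmult_lt_0_compat; lra); lra)
      1 Rlt_0_1)) as [t [Ht HDt]].
    generalize (HL t ltac:(lra)); lra. }
  unfold DL in Hneg; unfold DR; destruct Hsg as [->| ->].
  - assert (p za < F (v za)).
    { apply Rnot_le_lt; intros H; generalize (flux_le _ _ H); lra. }
    generalize (kin_lt (p za) (F (v za)) ltac:(lra)); lra.
  - assert (F (v za) < p za).
    { apply Rnot_le_lt; intros H; generalize (flux_le _ _ H); lra. }
    generalize (kin_lt (F (v za)) (p za) ltac:(lra)); lra. }
(* From [za] on, a negative [DR] does not increase, but [- DR <= p + F] tends to 0 at plus
   infinity. *)
destruct (LF' (- DR za) ltac:(lra)) as [M HM].
set (zb := Rmax za (M + 1)).
assert (Hzb : za <= zb /\ M + 1 <= zb) by (split; [apply Rmax_l|apply Rmax_r]).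
assert (I : DR zb <= DR za + 0 * (zb - za)).
{ apply (barrier DR za zb); try lra.
  - intros z _; apply (is_derive_continuous _ _ _ (dDR z)).
  - intros z Hz Hneg; eexists; split; [apply dDR|].
    assert (HF := PF _ (Hv01 z)); assert (Hpz := Hp z).
    assert (Hcmp : sg * (p z - F (v z)) <= 0).
    { apply Rnot_lt_le; intros H; unfold DR in Hneg; destruct Hsg as [->| ->].
      - generalize (kin_le (F (v z)) (p z) ltac:(lra)); lra.
      - generalize (kin_le (p z) (F (v z)) ltac:(lra)); lra. }
    replace (sg * (p z * (b * p z - b0 * F (v z))))
      with (- (p z * (b * - (sg * (p z - F (v z))) + - (sg * (b - b0)) * F (v z)))) by ring.
    assert (0 <= p z * (b * - (sg * (p z - F (v z))) + - (sg * (b - b0)) * F (v z))).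
    { apply Rmult_le_pos; [exact Hpz|].
      apply Rplus_le_le_0_compat; apply Rmult_le_pos; lra. }
    lra. }
specialize (HM zb ltac:(lra)).
assert (HF := PF _ (Hv01 zb)); assert (Hpz := Hp zb).
assert (A1 := kin_le_abs (p zb)); assert (A2 := kin_le_abs (F (v zb))).
rewrite (Rabs_pos_eq (p _)) in A1 by lra; rewrite (Rabs_pos_eq (F _)) in A2 by lra.
generalize (kin_range (p zb)) (kin_range (F (v zb))); intros.
assert (- (p zb + F (v zb)) <= DR zb);
  [unfold DR; destruct Hsg as [->| ->]; lra|lra].
Qed.

Lemma bistable_front_speed_unique h al ga l b0 C F b v p :
  bistable h al ga l -> orbit h b0 0 C F -> 0 <= b -> profile h b v p ->
  increasing v -> is_lim v m_infty 0 -> is_lim v p_infty 1 -> b = b0.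
Proof.
intros B HO Hb Hpr Hv L0 L1.
assert (H1 := front_speed_not_ordered h al ga l b0 C F b v p 1 B HO Hb Hpr Hv L0 L1
  (or_introl eq_refl)).
assert (H2 := front_speed_not_ordered h al ga l b0 C F b v p (-1) B HO Hb Hpr Hv L0 L1
  (or_intror eq_refl)).
lra.
Qed.

(** At a crossing of [al] the energy is at least its initial value [potential h 0 = 0], and the
    kinetic part is strictly below 1. *)
Lemma bistable_front_potential_bound h al ga l b v p :
  bistable h al ga l -> 0 <= b -> profile h b v p ->
  is_lim v m_infty 0 -> is_lim v p_infty 1 -> - potential h al < 1.
Proof.
intros B Hb Hpr L0 L1.
destruct (front_crosses v 0 1 al) as [za Hza]; auto.
{ intros z; apply (is_derive_continuous _ _ _ (profile_v _ _ _ _ Hpr z)). }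
{ apply (bi_al _ _ _ _ B). }
generalize (energy_ge_start h al ga l b v p 0 za B Hb Hpr L0).
unfold energy; rewrite potential_0, Hza; generalize (kin_range (p za)); lra.
Qed.

(** * Fronts of the original equation *)

Lemma increasing_of_slope_nonneg (v p : R -> R) :
  (forall z : R, is_derive v z (p z)) -> (forall z, 0 <= p z) -> increasing v.
Proof.
intros dv Hp x y Hxy.
enough (0 * (y - x) <= v y - v x) by lra.
apply increment_ge; [exact Hxy| |].
- intros t _; apply (is_derive_continuous _ _ _ (dv t)).
- intros t _; exists (p t); auto.
Qed.

Lemma decreasing_flip (v : R -> R) : decreasing v -> increasing (fun z => 1 - v z).
Proof. intros Hv x y Hxy; specialize (Hv x y Hxy); lra. Qed.

Lemma monotone_front_orientation (v : R -> R) (q1 q2 : R) :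
  q1 < q2 -> monotone v -> limits v q1 q2 \/ limits v q2 q1 ->
  (increasing v /\ limits v q1 q2) \/ (decreasing v /\ limits v q2 q1).
Proof.
intros Hq [Hv|Hv] [[L1 L2]|[L1 L2]].
- now left.
- generalize (increasing_ge_lim v q2 0 Hv L1) (increasing_le_lim v q1 0 Hv L2); lra.
- apply decreasing_flip in Hv.
  generalize (increasing_ge_lim _ _ 0 Hv (is_lim_flip _ _ _ L1)).
  generalize (increasing_le_lim _ _ 0 Hv (is_lim_flip _ _ _ L2)); lra.
- now right.
Qed.

Lemma Derive_flux_slope (v : R -> R) (z : R) :
  ex_derive (Derive v) z ->
  Derive (fun x => Derive v x / sqrt (1 + (Derive v x) ^ 2)) z
  = Derive (Derive v) z / curv (Derive v z).
Proof.
intros Hv; apply is_derive_unique.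
refine (is_derive_eq _ _ _ _ (is_derive_comp flux (Derive v) z _ _
  (is_derive_flux _) (Derive_correct _ _ Hv)) _).
unfold scal; simpl; unfold mult; simpl; unfold Rdiv; ring.
Qed.

Lemma profile_of_regular_profile (g h : R -> R) b v :
  (forall s, 0 <= s <= 1 -> h s = g s) -> regular_profile g b v ->
  profile h b v (Derive v).
Proof.
intros Hgh [Hc [Hr Hs]]; split.
- exact Hr.
- intros z; apply Derive_correct, Hc.
- intros z; destruct (Hc z) as [_ [H2 _]].
  specialize (Hs z); rewrite Derive_flux_slope in Hs by exact H2.
  rewrite Hgh by apply Hr.
  replace (curv (Derive v z) * (b * Derive v z - g (v z))) with (Derive (Derive v) z).
  + now apply Derive_correct.
  + generalize (curv_ge1 (Derive v z)); intros Hc1.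
    replace (b * Derive v z - g (v z)) with (Derive (Derive v) z / curv (Derive v z)) by lra.
    field; lra.
Qed.

Lemma regular_profile_of_profile (g h : R -> R) b v p :
  (forall s, continuous h s) -> (forall s, 0 <= s <= 1 -> h s = g s) ->
  profile h b v p -> regular_profile g b v.
Proof.
intros Ch Hgh [Hr dv dp].
assert (E : forall z, Derive v z = p z) by (intros z; apply is_derive_unique, dv).
assert (dE : forall z : R, is_derive (Derive v) z (curv (p z) * (b * p z - h (v z)))).
{ intros z; apply (is_derive_ext p); [intros; now rewrite E|apply dp]. }
assert (E2 : forall z, Derive (Derive v) z = curv (p z) * (b * p z - h (v z))).
{ intros z; apply is_derive_unique, dE. }
split; [|split; [exact Hr|]].
- intros z; split; [now exists (p z)|split; [eexists; apply dE|]].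
  apply (continuous_ext (fun z => curv (p z) * (b * p z - h (v z)))).
  { intros x; now rewrite E2. }
  assert (Cp : continuous p z) by apply (is_derive_continuous _ _ _ (dp z)).
  apply (continuous_mult (fun z => curv (p z)) (fun z => b * p z - h (v z))).
  + apply (continuous_comp p curv); [exact Cp|apply continuous_curv].
  + apply (continuous_minus (fun z => b * p z) (fun z => h (v z))).
    * apply (continuous_mult (fun _ => b) p); [apply continuous_const|exact Cp].
    * apply (continuous_comp v h); [apply (is_derive_continuous _ _ _ (dv z))|apply Ch].
- intros z; rewrite Derive_flux_slope by (eexists; apply dE).
  rewrite E2, !E, <- Hgh by apply Hr.
  field; generalize (curv_ge1 (p z)); lra.
Qed.

Lemma profile_flip_back h b v p :
  profile (fun s => - h (1 - s)) b v p -> profile h b (fun z => 1 - v z) (fun z => - p z).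
Proof.
intros Hpr; destruct (profile_flip _ _ _ _ Hpr) as [H1 H2 H3]; split; auto.
intros z; specialize (H3 z); cbv beta in H3.
replace (1 - (1 - (1 - v z))) with (1 - v z) in H3 by ring.
now rewrite Ropp_involutive in H3.
Qed.

Lemma upper_front_necessary g h al ga l b v :
  bistable h al ga l -> (forall s, 0 <= s <= 1 -> h s = g s) -> 0 <= b ->
  regular_heteroclinic_front g b al 1 v ->
  4 * ga <= b ^ 2 /\ increasing_front g b al 1 v.
Proof.
intros B Hgh Hb [Hreg [Hmon Hlim]]; assert (Hal := bi_al _ _ _ _ B).
assert (Hpr := profile_of_regular_profile g h b v Hgh Hreg).
destruct (monotone_front_orientation v al 1 ltac:(lra) Hmon Hlim)
  as [[Hv [L1 L2]]|[Hv [L1 L2]]].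
- split; [|exact (conj Hreg (conj Hv (conj L1 L2)))].
  now apply (monostable_front_speed h al ga l b v (Derive v)).
- exfalso; assert (H := potential_le_along_front h al ga l b v _ 1 al B Hb Hpr L1 L2).
  generalize (potential_lt_right h al ga l al 1 B); lra.
Qed.

Lemma lower_front_necessary g h al ga l b v :
  bistable h al ga l -> (forall s, 0 <= s <= 1 -> h s = g s) -> 0 <= b ->
  regular_heteroclinic_front g b 0 al v ->
  4 * ga <= b ^ 2 /\ decreasing_front g b 0 al v.
Proof.
intros B Hgh Hb [Hreg [Hmon Hlim]]; assert (Hal := bi_al _ _ _ _ B).
assert (Hpr := profile_of_regular_profile g h b v Hgh Hreg).
destruct (monotone_front_orientation v 0 al ltac:(lra) Hmon Hlim)
  as [[Hv [L1 L2]]|[Hv [L1 L2]]].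
- exfalso; assert (H := potential_le_along_front h al ga l b v _ 0 al B Hb Hpr L1 L2).
  generalize (potential_gt_left h al ga l 0 al B); lra.
- split; [|exact (conj Hreg (conj Hv (conj L1 L2)))].
  apply (monostable_front_speed _ (1 - al) ga l b (fun z => 1 - v z) (fun z => - Derive v z)
    (bistable_flip _ _ _ _ B) Hb (profile_flip _ _ _ _ Hpr) (decreasing_flip v Hv)).
  + now apply is_lim_flip.
  + generalize (is_lim_flip _ _ _ L2); now rewrite Rminus_0_r.
Qed.

(** The speed is compared with that of an arbitrary orbit, so that the one found by shooting can be
    inserted in the theorem. *)
Lemma full_front_necessary g h al ga l b v :
  bistable h al ga l -> 0 < potential h 1 ->
  (forall s, 0 <= s <= 1 -> h s = g s) -> 0 <= b ->
  regular_heteroclinic_front g b 0 1 v ->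
  - potential h al < 1 /\ (forall b0 C F, orbit h b0 0 C F -> b = b0) /\
  increasing_front g b 0 1 v.
Proof.
intros B HI Hgh Hb [Hreg [Hmon Hlim]].
assert (Hpr := profile_of_regular_profile g h b v Hgh Hreg).
destruct (monotone_front_orientation v 0 1 ltac:(lra) Hmon Hlim)
  as [[Hv [L1 L2]]|[Hv [L1 L2]]].
- split; [|split; [|exact (conj Hreg (conj Hv (conj L1 L2)))]].
  + now apply (bistable_front_potential_bound h al ga l b v (Derive v)).
  + intros b0 C F HO.
    now apply (bistable_front_speed_unique h al ga l b0 C F b v (Derive v)).
- exfalso; assert (H := potential_le_along_front h al ga l b v _ 1 0 B Hb Hpr L1 L2).
  rewrite potential_0 in H; lra.
Qed.

Lemma front_of_orbit g h b q C F :
  (forall s, continuous h s) -> (forall s, 0 <= s <= 1 -> h s = g s) -> 0 <= q < 1 ->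
  orbit h b q C F -> exists v, regular_heteroclinic_front g b q 1 v.
Proof.
intros Ch Hgh Hq HO.
destruct (profile_of_orbit h b q C F Hq HO) as [v [p [Hpr [Hp [L1 L2]]]]].
exists v; split; [|split; [|now left]].
- now apply (regular_profile_of_profile g h b v p).
- left; apply (increasing_of_slope_nonneg v p); [apply Hpr|].
  intros z; now apply Rlt_le.
Qed.

Lemma upper_front_exists g h al ga l b :
  bistable h al ga l -> (forall s, 0 <= s <= 1 -> h s = g s) -> 0 <= b ->
  4 * ga <= b ^ 2 -> exists v, regular_heteroclinic_front g b al 1 v.
Proof.
intros B Hgh Hb Hgb; assert (Hal := bi_al _ _ _ _ B).
destruct (monostable_orbit_exists h al ga l b B Hb Hgb) as [C [F HO]].
apply (front_of_orbit g h b al C F); auto; [apply (bi_cont _ _ _ _ B)|lra].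
Qed.

(** For the reflected nonlinearity the middle zero is [1 - al]; an increasing profile from there to
    1 becomes, through [1 - v], a decreasing one from [al] to 0. *)
Lemma lower_front_exists g h al ga l b :
  bistable h al ga l -> (forall s, 0 <= s <= 1 -> h s = g s) -> 0 <= b ->
  4 * ga <= b ^ 2 -> exists v, regular_heteroclinic_front g b 0 al v.
Proof.
intros B Hgh Hb Hgb; assert (Hal := bi_al _ _ _ _ B).
destruct (monostable_orbit_exists _ _ ga l b (bistable_flip _ _ _ _ B) Hb Hgb)
  as [C [F HO]].
destruct (profile_of_orbit _ b (1 - al) C F ltac:(lra) HO) as [v [p [Hpr [Hp [L1 L2]]]]].
exists (fun z => 1 - v z); split; [|split; [|right; split]].
- apply (regular_profile_of_profile g h b _ (fun z => - p z)).
  + apply (bi_cont _ _ _ _ B).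
  + exact Hgh.
  + now apply profile_flip_back.
- right; assert (Hi : increasing v).
  { apply (increasing_of_slope_nonneg v p); [apply Hpr|]; intros z; now apply Rlt_le. }
  intros x y Hxy; specialize (Hi x y Hxy); lra.
- replace al with (1 - (1 - al)) by ring; now apply is_lim_flip.
- generalize (is_lim_flip _ _ _ L2); now rewrite Rminus_diag.
Qed.

(** * From the data on [0,1] to a nonlinearity on the line *)

(** As [f] vanishes at 0 and 1, clamping the argument extends by zero and turns continuity relative
    to [0,1] into continuity on R. *)
Definition unit_extension (g : R -> R) (s : R) : R := g (clamp 1 s).

Lemma continuous_unit_extension (f : R -> R) (s : R) :
  continuous_on (fun s => 0 <= s <= 1) f -> continuous (unit_extension f) s.
Proof.
intros Hf.
assert (H01 : 0 <= clamp 1 s <= 1) by (apply clamp_range; lra).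
intros P HP; destruct (Hf (clamp 1 s) H01 P HP) as [d Hd].
destruct (proj1 (continuous_eps (clamp 1) s) (continuous_clamp 1 s Rle_0_1) d (cond_pos d))
  as [r [Hr Hc]].
exists (mkposreal r Hr); intros t Ht; apply Hd; [exact (Hc t Ht)|].
apply clamp_range; lra.
Qed.

Lemma reaction_term_sign f al s :
  reaction_term f al -> 0 < s < 1 -> (s < al -> f s < 0) /\ (al < s -> 0 < f s).
Proof.
intros Hf Hs; split; intros H.
- assert (A := reaction_sign _ _ Hf s Hs ltac:(lra)).
  apply Rnot_le_lt; intros Hn.
  assert (0 <= f s * - (s - al)) by (apply Rmult_le_pos; lra); lra.
- assert (A := reaction_sign _ _ Hf s Hs ltac:(lra)).
  apply Rnot_le_lt; intros Hn.
  assert (0 <= - f s * (s - al)) by (apply Rmult_le_pos; lra); lra.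
Qed.

Lemma unit_extension_g_eps f eps s :
  unit_extension (g_eps f eps) s = / eps * unit_extension f s.
Proof. unfold unit_extension, g_eps, Rdiv; ring. Qed.

Lemma bistable_of_reaction_term f al eps :
  reaction_term f al -> 0 < eps ->
  exists l, bistable (unit_extension (g_eps f eps)) al (Derive f al / eps) l.
Proof.
intros Hf Heps.
destruct (reaction_linear_bounds _ _ Hf) as [l [Hl Hlb]].
assert (Hal := reaction_alpha_range _ _ Hf).
assert (Hd := reaction_derive_pos _ _ Hf).
assert (Hi : 0 < / eps) by (now apply Rinv_0_lt_compat).
assert (Hid : forall s, 0 <= s <= 1 -> unit_extension (g_eps f eps) s = / eps * f s).
{ intros s Hs; rewrite unit_extension_g_eps; unfold unit_extension; now rewrite clamp_id. }
exists (l / eps); split.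
- intros s; apply (continuous_ext (fun s => / eps * unit_extension f s)).
  { intros x; now rewrite unit_extension_g_eps. }
  apply (continuous_mult (fun _ => / eps) (unit_extension f)); [apply continuous_const|].
  apply continuous_unit_extension, (reaction_continuous _ _ Hf).
- intros s [Hs|Hs]; rewrite unit_extension_g_eps; unfold unit_extension.
  + rewrite clamp_below, (reaction_zero _ _ Hf) by lra; ring.
  + rewrite clamp_above, (reaction_one _ _ Hf) by lra; ring.
- exact Hal.
- rewrite Hid, (reaction_alpha _ _ Hf) by lra; ring.
- intros s Hs; rewrite Hid by lra.
  assert (f s < 0) by (apply (reaction_term_sign f al); [exact Hf|lra|lra]).
  assert (0 < / eps * - f s) by (apply Rmult_lt_0_compat; lra); lra.
- intros s Hs; rewrite Hid by lra; apply Rmult_lt_0_compat; [exact Hi|].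
  apply (reaction_term_sign f al); [exact Hf|lra|lra].
- apply (is_derive_ext_loc (fun s => / eps * f s)).
  + assert (Hr : 0 < Rmin al (1 - al)) by (apply Rmin_glb_lt; lra).
    exists (mkposreal _ Hr); intros t Ht; symmetry; apply Hid.
    assert (Ht' : Rabs (t - al) < Rmin al (1 - al)) by exact Ht.
    apply Rabs_lt_between in Ht'.
    generalize (Rmin_l al (1 - al)) (Rmin_r al (1 - al)); lra.
  + replace (Derive f al / eps) with (/ eps * Derive f al) by (unfold Rdiv; ring).
    apply (is_derive_scal f), Derive_correct, (reaction_ex_derive _ _ Hf).
- now apply Rdiv_lt_0_compat.
- intros s Hs; rewrite Hid, Rabs_mult, (Rabs_pos_eq (/ eps)) by lra.
  replace (Derive f al / eps * Rabs (s - al)) with (/ eps * (Derive f al * Rabs (s - al)))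
    by (unfold Rdiv; ring).
  apply Rmult_le_compat_l; [lra|now apply (reaction_tangent _ _ Hf)].
- now apply Rdiv_lt_0_compat.
- intros s Hs; rewrite Hid by exact Hs.
  replace (- (l / eps) * s) with (/ eps * (- l * s)) by (unfold Rdiv; ring).
  apply Rmult_le_compat_l; [lra|]; now apply Rge_le, Hlb.
- intros s Hs; rewrite Hid by exact Hs.
  replace (l / eps * (1 - s)) with (/ eps * (l * (1 - s))) by (unfold Rdiv; ring).
  apply Rmult_le_compat_l; [lra|]; now apply Hlb.
Qed.

Lemma ex_RInt_unit_extension f a b :
  continuous_on (fun s => 0 <= s <= 1) f -> ex_RInt (unit_extension f) a b.
Proof.
intros Hf; apply (ex_RInt_continuous (unit_extension f)); intros z _.
now apply continuous_unit_extension.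
Qed.

Lemma potential_unit_extension_g_eps f eps s :
  continuous_on (fun s => 0 <= s <= 1) f ->
  potential (unit_extension (g_eps f eps)) s = / eps * RInt (unit_extension f) 0 s.
Proof.
intros Hf; unfold potential.
transitivity (RInt (fun x => / eps * unit_extension f x) 0 s).
- apply RInt_ext; intros x _; apply unit_extension_g_eps.
- exact (RInt_scal (V := R_CompleteNormedModule) (unit_extension f)
    0 s (/ eps) (ex_RInt_unit_extension f 0 s Hf)).
Qed.

Lemma RInt_reaction_term f al :
  reaction_term f al -> RInt f 0 1 = RInt (unit_extension f) 0 1.
Proof.
intros Hf; apply RInt_ext; intros x Hx; rewrite Rmin_left, Rmax_right in Hx by lra.
unfold unit_extension; rewrite clamp_id; [reflexivity|lra].
Qed.

(** The negative part lives on [0, al] only; its integral is therefore [eps] times the depth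
    [- potential h al] of the well. *)
Lemma RInt_neg_part_reaction_term f al :
  reaction_term f al -> RInt (neg_part f) 0 1 = - RInt (unit_extension f) 0 al.
Proof.
intros Hf; assert (Hal := reaction_alpha_range _ _ Hf).
assert (E1 : forall x, Rmin 0 al < x < Rmax 0 al -> - unit_extension f x = neg_part f x).
{ intros x Hx; rewrite Rmin_left, Rmax_right in Hx by lra.
  unfold unit_extension, neg_part; rewrite clamp_id by lra.
  destruct (reaction_term_sign f al x Hf ltac:(lra)) as [H _].
  rewrite Rmax_left; [reflexivity|]; specialize (H ltac:(lra)); lra. }
assert (E2 : forall x, Rmin al 1 < x < Rmax al 1 -> 0 = neg_part f x).
{ intros x Hx; rewrite Rmin_left, Rmax_right in Hx by lra.
  destruct (reaction_term_sign f al x Hf ltac:(lra)) as [_ H].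
  unfold neg_part; rewrite Rmax_right; [reflexivity|]; specialize (H ltac:(lra)); lra. }
assert (X := ex_RInt_unit_extension f 0 al (reaction_continuous _ _ Hf)).
assert (X1 : ex_RInt (neg_part f) 0 al).
{ apply (ex_RInt_ext (fun x => - unit_extension f x)); [exact E1|].
  now apply (ex_RInt_opp (V := R_NormedModule)). }
assert (X2 : ex_RInt (neg_part f) al 1).
{ apply (ex_RInt_ext (fun _ => 0)); [exact E2|apply ex_RInt_const]. }
rewrite <- (RInt_Chasles (neg_part f) 0 al 1 X1 X2).
rewrite <- (RInt_ext (fun x => - unit_extension f x) _ _ _ E1).
rewrite <- (RInt_ext (fun _ => 0) _ _ _ E2), RInt_const.
change (fun x => - unit_extension f x)
  with (fun x => opp (unit_extension f x : R_CompleteNormedModule)).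
rewrite (RInt_opp (V := R_CompleteNormedModule) (unit_extension f) 0 al X).
unfold plus, opp, scal; simpl; unfold mult; simpl; ring.
Qed.

Lemma ge_b_plus_iff f al eps b :
  0 <= b -> 0 < Derive f al / eps ->
  b >= b_plus f al eps <-> 4 * (Derive f al / eps) <= b ^ 2.
Proof.
intros Hb Hg; rewrite b_plusE; set (ga := Derive f al / eps) in *.
assert (Hs := sqrt_pos ga); assert (Hsq : sqrt ga ^ 2 = ga) by (apply pow2_sqrt; lra).
split; intros H.
- assert ((2 * sqrt ga) ^ 2 <= b ^ 2) by (apply pow_incr; lra).
  replace ((2 * sqrt ga) ^ 2) with (4 * sqrt ga ^ 2) in H0 by ring; lra.
- apply Rle_ge, Rnot_lt_le; intros Hlt.
  assert (b * b < (2 * sqrt ga) * (2 * sqrt ga)) by (apply Rmult_le_0_lt_compat; lra).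
  replace (2 * sqrt ga * (2 * sqrt ga)) with (4 * sqrt ga ^ 2) in H0 by ring; lra.
Qed.

Theorem proposition2p1 (f : R -> R) (alpha eps : R)
    (Hf : reaction_term f alpha) (Heps : 0 < eps) :
  exists bstar : R,
    0 < bstar < b_plus f alpha eps /\
    forall b q1 q2 : R,
      0 <= b ->
      (q1 = 0 \/ q1 = alpha \/ q1 = 1) ->
      (q2 = 0 \/ q2 = alpha \/ q2 = 1) ->
      q1 < q2 ->
      let case_i := q1 = alpha /\ q2 = 1 /\ b >= b_plus f alpha eps in
      let case_ii := q1 = 0 /\ q2 = alpha /\ b >= b_plus f alpha eps in
      let case_iii :=
        q1 = 0 /\ q2 = 1 /\ eps > RInt (neg_part f) 0 1 /\ b = bstar in
      ((exists v : R -> R,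
          regular_heteroclinic_front (g_eps f eps) b q1 q2 v)
       <-> case_i \/ case_ii \/ case_iii) /\
      (forall v : R -> R,
         regular_heteroclinic_front (g_eps f eps) b q1 q2 v ->
         (case_i -> increasing_front (g_eps f eps) b q1 q2 v) /\
         (case_ii -> decreasing_front (g_eps f eps) b q1 q2 v) /\
         (case_iii -> increasing_front (g_eps f eps) b q1 q2 v)).
Proof.
destruct (bistable_of_reaction_term f alpha eps Hf Heps) as [l B].
assert (Hgh : forall s, 0 <= s <= 1 -> unit_extension (g_eps f eps) s = g_eps f eps s).
{ intros s Hs; unfold unit_extension; now rewrite clamp_id. }
assert (Hal := bi_al _ _ _ _ B); assert (Hg := bi_ga _ _ _ _ B).
assert (Hi : 0 < / eps) by (now apply Rinv_0_lt_compat).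
assert (HG : forall s, potential (unit_extension (g_eps f eps)) s
  = / eps * RInt (unit_extension f) 0 s).
{ intros s; apply potential_unit_extension_g_eps, (reaction_continuous _ _ Hf). }
set (h := unit_extension (g_eps f eps)) in *.
set (ga := Derive f alpha / eps) in *.
assert (HI : 0 < potential h 1).
{ rewrite HG, <- (RInt_reaction_term f alpha Hf); apply Rmult_lt_0_compat; [exact Hi|].
  apply (reaction_mean _ _ Hf). }
(* The threshold on [eps] says that the well is shallower than 1, the supremum of [kin]. *)
assert (Hk : eps > RInt (neg_part f) 0 1 <-> - potential h alpha < 1).
{ rewrite HG, (RInt_neg_part_reaction_term f alpha Hf).
  set (I := RInt (unit_extension f) 0 alpha).
  replace (- (/ eps * I)) with (- I / eps) by (unfold Rdiv; ring).
  rewrite Rlt_div_l by exact Heps; lra. }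
assert (Hb : exists bstar, 0 < bstar < b_plus f alpha eps /\
  (- potential h alpha < 1 -> exists C F, orbit h bstar 0 C F)).
{ rewrite b_plusE; fold ga.
  destruct (Rlt_le_dec (- potential h alpha) 1) as [H|H].
  - destruct (bistable_orbit_exists h alpha ga l B HI H) as [b [C [F [Hb HO]]]].
    exists b; split; [exact Hb|]; intros _; now exists C, F.
  (* Below the threshold no front joins 0 and 1, and any value between 0 and [b_plus] will do; this
     is its half. *)
  - exists (sqrt ga); split; [|lra].
    assert (0 < sqrt ga) by (now apply sqrt_lt_R0); lra. }
destruct Hb as [bstar [Hbs Horb]].
exists bstar; split; [exact Hbs|].
intros b q1 q2 Hb Hq1 Hq2 Hq case_i case_ii case_iii.
assert (Hbp := ge_b_plus_iff f alpha eps b Hb Hg); fold ga in Hbp.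
assert (Hcases : (q1 = alpha /\ q2 = 1) \/ (q1 = 0 /\ q2 = alpha) \/ (q1 = 0 /\ q2 = 1))
  by lra.
clear Hq1 Hq2 Hq.
destruct Hcases as [[E1 E2]|[[E1 E2]|[E1 E2]]]; subst q1 q2.
- assert (N := fun v => upper_front_necessary (g_eps f eps) h alpha ga l b v B Hgh Hb).
  split; [split|].
  + intros [v Hv]; left; repeat split; now apply Hbp, (N v).
  + intros [[_ [_ H]]|[[H _]|[H _]]]; try lra.
    now apply (upper_front_exists _ h alpha ga l), Hbp.
  + intros v Hv; split; [now intros _; apply N|].
    split; intros [H _]; lra.
- assert (N := fun v => lower_front_necessary (g_eps f eps) h alpha ga l b v B Hgh Hb).
  split; [split|].
  + intros [v Hv]; right; left; repeat split; now apply Hbp, (N v).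
  + intros [[H _]|[[_ [_ H]]|[_ [H _]]]]; try lra.
    now apply (lower_front_exists _ h alpha ga l), Hbp.
  + intros v Hv; split; [intros [H _]; lra|].
    split; [now intros _; apply N|intros [_ [H _]]; lra].
- assert (N := fun v => full_front_necessary (g_eps f eps) h alpha ga l b v B HI Hgh Hb).
  split; [split|].
  + intros [v Hv]; destruct (N v Hv) as [Hlt [Hu _]].
    right; right; repeat split; [now apply Hk|].
    destruct (Horb Hlt) as [C [F HO]]; now apply (Hu bstar C F).
  + intros [[H _]|[[_ [H _]]|[_ [_ [H ->]]]]]; try lra.
    destruct (Horb (proj1 Hk H)) as [C [F HO]].
    apply (front_of_orbit _ h bstar 0 C F); auto; [apply (bi_cont _ _ _ _ B)|lra].
  + intros v Hv; split; [intros [H _]; lra|].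
    split; [intros [_ [H _]]; lra|now intros _; apply N].
Qed.
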